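(* Let $\mathcal{A}=\{H_1,\dots,H_n\}$ be a central hyperplane arrangement in $V\cong\mathbb{R}^\ell$, oriented so that the cone is $\mathcal{K}=\bigcap_{i\in W}H_i^+$ for some $W\subseteq[n]$, and let $\mathcal{G}\subseteq\mathbb{Z}[e_1,\dots,e_n]$ be the set of relations described in the context. Choose a monomial order $\prec$ on $\mathbb{Z}[e_1,\dots,e_n]$ which refines the ordering by degree. Then the map $e_i\mapsto x_i$ induces ring isomorphisms \[ VG(\mathcal{K})\cong \mathbb{Z}[e_1,\dots,e_n]/(\mathcal{G}),\qquad \mathcal{V}(\mathcal{K})\cong \mathbb{Z}[e_1,\dots,e_n]/(\mathrm{in}_{\deg}(\mathcal{G})), \] where $\mathrm{in}_{\deg}(\mathcal{G})=\{\mathrm{in}_{\deg}(g): g\in\mathcal{G}\}$, and both rings are free $\mathbb{Z}$-modules with bases given by the images of the $\mathcal{K}$-NBC monomials $\{e_N\}_{N\in NBC(\mathcal{K})}$, where $e_N=\prod_{i\in N}e_i$. In particular, \[ \mathrm{Hilb}(\mathcal{V}(\mathcal{K}),t)=\sum_{N\in NBC(\mathcal{K})}t^{\#N}=\mathrm{Poin}(\mathcal{K},t). \]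
   Context: $\mathcal{A}=\{H_1,\dots,H_n\}$ is a finite set of distinct linear hyperplanes $H_i=\{\mathbf{x}: v_i\cdot\mathbf{x}=0\}$ in $V=\mathbb{R}^\ell$ with fixed normal vectors $v_i$; $H_i^+=\{\mathbf{x}: v_i\cdot \mathbf{x}>0\}$, $H_i^-=\{\mathbf{x}:v_i\cdot\mathbf{x}<0\}$. A chamber of $\mathcal{A}$ is a connected component of $V\setminus\bigcup_i H_i$. The cone $\mathcal{K}=\bigcap_{i\in W}H_i^+$ (with $W\subseteq[n]$ possibly redundant; $W=\emptyset$ gives $\mathcal{K}=V$) is assumed to be such a set; $\mathcal{C}(\mathcal{K})$ is the set of chambers of $\mathcal{A}$ contained in $\mathcal{K}$. $\mathcal{L}^{\mathrm{int}}(\mathcal{K})$ is the set of intersections $X=\bigcap_{i\in S}H_i$ ($S\subseteq[n]$, including $X=V$) with $X\cap\mathcal{K}\neq\emptyset$, ordered by reverse inclusion, with Möbius function $\mu$; $\mathrm{Poin}(\mathcal{K},t)=\sum_{X\in\mathcal{L}^{\mathrm{int}}(\mathcal{K})}|\mu(V,X)|\,t^{\mathrm{codim}X}$. $VG(\mathcal{K})$ is the ring of all functions $\mathcal{C}(\mathcal{K})\to\mathbb{Z}$ under pointwise addition and multiplication. The Heaviside function $x_i\in VG(\mathcal{K})$ is $x_i(C)=1$ if $C\subseteq H_i^+$ and $0$ otherwise. The degree filtration is $F_d$ = the $\mathbb{Z}$-span of products of at most $d$ Heaviside functions ($F_{-1}=0$), and $\mathcal{V}(\mathcal{K})=\bigoplus_{d\ge0}F_d/F_{d-1}$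 is the associated graded ring, with $\mathrm{Hilb}(\mathcal{V}(\mathcal{K}),t)=\sum_d \mathrm{rank}_\mathbb{Z}(F_d/F_{d-1})t^d$; in the isomorphism for $\mathcal{V}(\mathcal{K})$, $e_i$ maps to the class of $x_i$ in $F_1/F_0$. A signed dependency is a pair $D=(D^+,D^-)$ of disjoint subsets of $[n]$ arising from a linear relation $\sum_i\lambda_iv_i=0$ with $D^+=\{i:\lambda_i>0\}$, $D^-=\{i:\lambda_i<0\}$; $\underline{D}=D^+\cup D^-$. A signed circuit is a nonzero signed dependency whose support $\underline{C}$ is minimal under inclusion. A broken circuit is $\underline{C}\setminus\{\min\underline{C}\}$ for a signed circuit $C$ (minimum in the usual order of $[n]$). $N\subseteq[n]$ is an NBC set if it contains no broken circuit, and a $\mathcal{K}$-NBC set if moreover $\bigcap_{i\in N}H_i\in\mathcal{L}^{\mathrm{int}}(\mathcal{K})$; $NBC(\mathcal{K})$ is the set of these. For $S\subseteq[n]$, $e_S=\prod_{i\in S}e_i$. $\mathcal{G}$ consists of: (Idempotent) $e_i^2-e_i$ for all $i\in[n]$; (Unit) $e_i-1$ for $i\in W$; (Cone Circuit) for each signed circuit $C$ with $\emptyset\neq W\cap C^+=W\cap\underline{C}$, the polynomial $e_{C^+\setminus W}\prod_{j\in C^-}(e_j-1)$, and for each signed circuit with $\emptyset\neq W\cap C^-=W\cap\underline{C}$, the polynomial $e_{C^-\setminus W}\prod_{j\in C^+}(e_j-1)$; (Circuit) for each signed circuit $C$ with $W\cap\underline{C}=\emptyset$, the polynomial $e_{C^+}\prod_{j\in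 C^-}(e_j-1)-e_{C^-}\prod_{j\in C^+}(e_j-1)$. For a polynomial $f$, $\mathrm{in}_{\deg}(f)$ is the sum of the terms of $f$ of maximal total degree. *)

(* Defs.v *)
From HB Require Import structures.
(* mpoly has to be imported before the analysis library, with which its
   notations would otherwise clash. *)
From mathcomp Require Import mpoly.
From mathcomp Require Import all_boot all_order all_algebra.
From mathcomp Require Import all_classical all_reals topology normedtype.

Set Implicit Arguments.
Unset Strict Implicit.
Unset Printing Implicit Defensive.

Import Order.TTheory GRing.Theory Num.Theory numFieldNormedType.Exports.

Local Open Scope classical_set_scope.
Local Open Scope ring_scope.
Local Open Scope quotient_scope.

Section IntModules.
Variable M : zmodType.

Definition Zspan (S : set M) (a : M) : bool :=
  `[< exists s : seq (int * M),
        (forall p, p \in s -> S p.2) /\ a = \sum_(p <- s) p.2 *~ p.1 >].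

Lemma Zspan_zmod_closed (S : set M) : zmod_closed (Zspan S).
Proof.
split; first by apply/asboolP; exists [::]; rewrite big_nil.
move=> _ _ /asboolP[s [Ss ->]] /asboolP[t [St ->]]; apply/asboolP.
exists (s ++ [seq (- p.1, p.2) | p <- t]); split.
  move=> p; rewrite mem_cat => /orP[/Ss //|/mapP[q /St Sq ->]]; exact: Sq.
rewrite big_cat big_map; congr (_ + _); rewrite -sumrN.
by apply: eq_bigr => p _; rewrite mulrNz.
Qed.

HB.instance Definition _ (S : set M) :=
  GRing.isZmodClosed.Build M (Zspan S) (Zspan_zmod_closed S).

Lemma Zspan_gen (S : set M) a : S a -> a \in Zspan S.
Proof.
move=> Sa; apply/asboolP; exists [:: (1, a)]; split=> [p|].
  by rewrite inE => /eqP->.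
by rewrite big_seq1 mulr1z.
Qed.

Definition Zindependent (T : finType) (A : {set T}) (b : T -> M) : Prop :=
  forall c : T -> int,
    \sum_(i in A) b i *~ c i = 0 -> forall i, i \in A -> c i = 0.

Definition Zbasis (T : finType) (A : {set T}) (b : T -> M) : Prop :=
  Zindependent A b /\
  forall m : M, exists c : T -> int, m = \sum_(i in A) b i *~ c i.

Definition has_Zrank (r : nat) : Prop :=
  (exists b : 'I_r -> M, Zindependent [set: 'I_r]%SET b) /\
  forall k (b : 'I_k -> M), Zindependent [set: 'I_k]%SET b -> (k <= r)%N.

End IntModules.

(* The quotients of the library require a proper ideal; here the ideal may be
   the whole ring, as happens when the cone is empty. *)
Section IdealQuotient.
Variables (A : comPzRingType) (G : set A).

Definition ideal_gen (a : A) : bool :=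
  `[< exists s : seq (A * A),
        (forall p, p \in s -> G p.2) /\ a = \sum_(p <- s) p.1 * p.2 >].

Lemma ideal_gen_mull a b : b \in ideal_gen -> a * b \in ideal_gen.
Proof.
move=> /asboolP[s [Gs ->]]; apply/asboolP.
exists [seq (a * p.1, p.2) | p <- s]; split.
  by move=> p /mapP[q /Gs Gq ->].
by rewrite big_map mulr_sumr; apply: eq_bigr => p _; rewrite mulrA.
Qed.

Lemma ideal_gen_zmod_closed : zmod_closed ideal_gen.
Proof.
split; first by apply/asboolP; exists [::]; rewrite big_nil.
move=> x y Ix Iy; rewrite -mulN1r.
have /asboolP[t [Gt ->]] := ideal_gen_mull (- 1) Iy.
case/asboolP: Ix => s [Gs ->]; apply/asboolP; exists (s ++ t); split.
  by move=> p; rewrite mem_cat => /orP[/Gs|/Gt].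
by rewrite big_cat.
Qed.

HB.instance Definition _ :=
  GRing.isZmodClosed.Build A ideal_gen ideal_gen_zmod_closed.

Let quot_zmod := Quotient.quot (GRing.ZmodClosed.clone A ideal_gen _).

Definition quot_ring : Type := quot_zmod.
HB.instance Definition _ := GRing.Zmodule.on quot_ring.

Definition qclass (a : A) : quot_ring := \pi_quot_zmod a.

Definition qmul (x y : quot_ring) : quot_ring :=
  qclass (repr (x : quot_zmod) * repr (y : quot_zmod)).

Lemma qclassE a b : (qclass a = qclass b) <-> (a - b \in ideal_gen).
Proof.
split=> [/eqP|h]; first by rewrite -Quotient.idealrBE.
by apply/eqP; rewrite -Quotient.idealrBE.
Qed.

Lemma qclassK (x : quot_ring) : qclass (repr (x : quot_zmod)) = x.
Proof. exact: reprK. Qed.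

Lemma qclassD : {morph qclass : a b / a + b}.
Proof. by move=> a b; exact: (raddfD \pi_quot_zmod). Qed.

Lemma qclassM a b : qclass (a * b) = qmul (qclass a) (qclass b).
Proof.
rewrite /qmul; apply/qclassE.
set a' := repr _; set b' := repr _.
have /qclassE Ha : qclass a = qclass a' by rewrite qclassK.
have /qclassE Hb : qclass b = qclass b' by rewrite qclassK.
have -> : a * b - a' * b' = b * (a - a') + a' * (b - b').
  by rewrite !mulrBr addrA (mulrC b a) (mulrC b a') subrK.
by rewrite rpredD // ideal_gen_mull.
Qed.

Lemma qmulA : associative qmul.
Proof.
by move=> x y z; rewrite -(qclassK x) -(qclassK y) -(qclassK z) -!qclassM mulrA.
Qed.

Lemma qmulC : commutative qmul.
Proof. by move=> x y; rewrite -(qclassK x) -(qclassK y) -!qclassM mulrC. Qed.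

Lemma qmul1 : left_id (qclass 1) qmul.
Proof. by move=> x; rewrite -(qclassK x) -qclassM mul1r. Qed.

Lemma qmulD : left_distributive qmul +%R.
Proof.
move=> x y z; rewrite -(qclassK x) -(qclassK y) -(qclassK z).
by rewrite -qclassD -!qclassM mulrDl qclassD.
Qed.

HB.instance Definition _ :=
  GRing.Zmodule_isComPzRing.Build quot_ring qmulA qmulC qmul1 qmulD.

End IdealQuotient.

Section AssociatedGraded.
Variables (A : comPzRingType) (n : nat) (x : 'I_n -> A).

Definition filt (d : nat) : A -> bool :=
  Zspan [set a : A | exists2 s : seq 'I_n,
                       (size s <= d)%N & a = \prod_(i <- s) x i].

HB.instance Definition _ d := GRing.ZmodClosed.on (filt d).

(* F_{d-1}, with F_{-1} = 0. *)
Definition filt_prev (d : nat) (a : A) : bool :=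
  if d is d'.+1 then filt d' a else a == 0.

Lemma filt_prev_zmod_closed d : zmod_closed (filt_prev d).
Proof.
case: d => [|d]; last by split=> [|a b Fa Fb]; [exact: rpred0|exact: rpredB].
by split=> [|a b /eqP-> /eqP->]; rewrite unfold_in /= ?subr0.
Qed.

HB.instance Definition _ d :=
  GRing.isZmodClosed.Build A (filt_prev d) (filt_prev_zmod_closed d).

Lemma filt_le d e a : (d <= e)%N -> a \in filt d -> a \in filt e.
Proof.
move=> le_de /asboolP[s [Ss ->]]; apply/asboolP; exists s; split=> // p.
by move=> /Ss[t st ->]; exists t => //; exact: leq_trans le_de.
Qed.

Lemma filt_prev_sub d a : a \in filt_prev d -> a \in filt d.
Proof.
case: d => [/eqP->|d]; first exact: rpred0.
exact: filt_le.
Qed.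

Lemma filt_mul i j a b :
  a \in filt i -> b \in filt j -> a * b \in filt (i + j).
Proof.
move=> /asboolP[s [Ss ->]] /asboolP[t [St ->]].
rewrite mulr_suml big_seq rpred_sum // => p /Ss[u su ->].
rewrite mulr_sumr big_seq rpred_sum // => q /St[w sw ->].
rewrite mulrzAl mulrzAr !rpredMz // -big_cat; apply: Zspan_gen.
by exists (u ++ w) => //; rewrite size_cat leq_add.
Qed.

Lemma filt_prev_mul i j a b :
  a \in filt_prev i -> b \in filt j -> a * b \in filt_prev (i + j).
Proof.
case: i => [/eqP-> _|i Fa Fb]; first by rewrite mul0r rpred0.
exact: filt_mul.
Qed.

Lemma filt_gen i : x i \in filt 1.
Proof. by apply: Zspan_gen; exists [:: i] => //; rewrite big_seq1. Qed.

Lemma filt1 : 1 \in filt 0.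
Proof. by apply: Zspan_gen; exists [::] => //; rewrite big_nil. Qed.

Definition filt_type (d : nat) : Type := {a : A | filt d a}.
HB.instance Definition _ d := SubChoice.on (filt_type d).
HB.instance Definition _ d :=
  [SubChoice_isSubZmodule of filt_type d by <:].

Definition filt_down (d : nat) (u : filt_type d) : bool := filt_prev d (val u).

Lemma filt_down_zmod_closed d : zmod_closed (@filt_down d).
Proof.
split; first by rewrite unfold_in /filt_down raddf0; apply: (filt_prev_zmod_closed d).1.
by move=> u w Fu Fw; rewrite unfold_in /filt_down raddfB; apply: (filt_prev_zmod_closed d).2.
Qed.

HB.instance Definition _ d :=
  GRing.isZmodClosed.Build (filt_type d) (@filt_down d)
    (filt_down_zmod_closed d).

Local Notation gr_quot d :=
  (Quotient.quot (GRing.ZmodClosed.clone (filt_type d) (@filt_down d) _)).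

Definition gr (d : nat) : Type := gr_quot d.
HB.instance Definition _ d := GRing.Zmodule.on (gr d).

(* Meaningful for a in filt d only: all other elements are sent to 0. *)
Definition gr_class (d : nat) (a : A) : gr d :=
  \pi_(gr_quot d) (insubd (0 : filt_type d) a).

Definition gr_repr (d : nat) (u : gr d) : A := val (repr (u : gr_quot d)).

Lemma gr_repr_filt d (u : gr d) : gr_repr u \in filt d.
Proof. exact: valP. Qed.

Lemma gr_reprK d (u : gr d) : gr_class d (gr_repr u) = u.
Proof. by rewrite /gr_class /gr_repr valKd; exact: reprK. Qed.

Lemma gr_classE d a b : a \in filt d -> b \in filt d ->
  (gr_class d a = gr_class d b) <-> (a - b \in filt_prev d).
Proof.
move=> Fa Fb.
suff -> : (a - b \in filt_prev d) = (gr_class d a == gr_class d b).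
  by split=> [->|/eqP].
rewrite /gr_class -[RHS]Quotient.idealrBE.
transitivity (filt_prev d (val ((insubd 0 a : filt_type d) - insubd 0 b))) => //.
by rewrite raddfB /= !insubdK.
Qed.

Lemma gr_classD d a b : a \in filt d -> b \in filt d ->
  gr_class d (a + b) = gr_class d a + gr_class d b.
Proof.
move=> Fa Fb; rewrite /gr_class -[RHS](raddfD \pi_(gr_quot d)).
congr (\pi_(gr_quot d) _); apply: val_inj; rewrite raddfD /= !insubdK //.
exact: rpredD.
Qed.

Lemma gr_class0 d : gr_class d 0 = 0.
Proof.
rewrite /gr_class -[RHS](raddf0 \pi_(gr_quot d)).
congr (\pi_(gr_quot d) _); apply: val_inj; rewrite raddf0 insubdK //.
exact: rpred0.
Qed.

Lemma gr_class_sum d I (r : seq I) (F : I -> A) :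
  (forall i, F i \in filt d) ->
  gr_class d (\sum_(i <- r) F i) = \sum_(i <- r) gr_class d (F i).
Proof.
move=> FF; elim: r => [|i r IH]; first by rewrite !big_nil gr_class0.
by rewrite !big_cons gr_classD ?rpred_sum // IH.
Qed.

(* The product F_i/F_{i-1} x F_j/F_{j-1} -> F_d/F_{d-1}, used for d = i + j:
   keeping d separate avoids transporting along such equalities. *)
Definition gr_mul (i j d : nat) (u : gr i) (w : gr j) : gr d :=
  gr_class d (gr_repr u * gr_repr w).

Lemma gr_mul_class i j d a b : (i + j)%N = d ->
  a \in filt i -> b \in filt j ->
  gr_mul d (gr_class i a) (gr_class j b) = gr_class d (a * b).
Proof.
move=> <- Fa Fb; rewrite /gr_mul.
set a' := gr_repr _; set b' := gr_repr _.
have Fa' : a' \in filt i by exact: gr_repr_filt.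
have Fb' : b' \in filt j by exact: gr_repr_filt.
have Ha : a' - a \in filt_prev i by apply/gr_classE; rewrite // gr_reprK.
have Hb : b' - b \in filt_prev j by apply/gr_classE; rewrite // gr_reprK.
apply/gr_classE; [exact: filt_mul..|].
have -> : a' * b' - a * b = (a' - a) * b' + (b' - b) * a.
  by rewrite !mulrBl addrA (mulrC b' a) subrK (mulrC b a).
by apply: rpredD; [|rewrite addnC]; exact: filt_prev_mul.
Qed.

Definition finite_support (a : forall d, gr d) : Prop :=
  exists N : nat, forall d, (N <= d)%N -> a d = 0.

Record graded : Type := Graded {
  component :> forall d, gr d;
  componentP : finite_support component }.

HB.instance Definition _ := gen_eqMixin graded.
HB.instance Definition _ := gen_choiceMixin graded.

Lemma gradedP (a b : graded) : (forall d, a d = b d) -> a = b.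
Proof.
case: a b => [a Ha] [b Hb] /= eq_ab.
have ab : a = b by exact: functional_extensionality_dep.
by subst b; congr Graded; exact: Prop_irrelevance.
Qed.

Lemma gr0_support : finite_support (fun d => 0).
Proof. by exists 0%N. Qed.

Lemma grD_support (a b : graded) : finite_support (fun d => a d + b d).
Proof.
have [[N HN] [M HM]] := (componentP a, componentP b).
exists (maxn N M) => d; rewrite geq_max => /andP[Nd Md].
by rewrite HN // HM // addr0.
Qed.

Lemma grN_support (a : graded) : finite_support (fun d => - a d).
Proof. by have [N HN] := componentP a; exists N => d Nd; rewrite HN ?oppr0. Qed.

Lemma grM_support (a b : graded) :
  finite_support (fun d => \sum_(i < d.+1) gr_mul d (a i) (b (d - i)%N)).
Proof.
have [[N HN] [M HM]] := (componentP a, componentP b).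
exists (N + M)%N => d NMd; apply: big1 => i _.
have le_id : (i + (d - i))%N = d by rewrite subnKC // -ltnS.
have [Ni|iN] := leqP N i.
  rewrite HN // -(gr_class0 i) -(gr_reprK (b _)).
  by rewrite gr_mul_class ?mul0r ?gr_class0 ?rpred0 ?gr_repr_filt.
rewrite HM; last first.
  rewrite leq_subRL; last by rewrite -ltnS.
  by apply: leq_trans NMd; rewrite leq_add2r ltnW.
rewrite -(gr_class0 (d - i)) -(gr_reprK (a i)).
by rewrite gr_mul_class ?mulr0 ?gr_class0 ?rpred0 ?gr_repr_filt.
Qed.

Lemma gr_in_support d (a : A) :
  finite_support (fun e => if e == d then gr_class e a else 0).
Proof. by exists d.+1 => e; case: eqP => // ->; rewrite ltnn. Qed.

Definition gr_in (d : nat) (a : A) : graded := Graded (gr_in_support d a).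

Definition graded0 : graded := Graded gr0_support.
Definition gradedD (a b : graded) : graded := Graded (grD_support a b).
Definition gradedN (a : graded) : graded := Graded (grN_support a).
Definition gradedM (a b : graded) : graded := Graded (grM_support a b).

Lemma gradedDA : associative gradedD.
Proof. by move=> a b c; apply: gradedP => d /=; rewrite addrA. Qed.
Lemma gradedDC : commutative gradedD.
Proof. by move=> a b; apply: gradedP => d /=; rewrite addrC. Qed.
Lemma gradedD0 : left_id graded0 gradedD.
Proof. by move=> a; apply: gradedP => d /=; rewrite add0r. Qed.
Lemma gradedDN : left_inverse graded0 gradedN gradedD.
Proof. by move=> a; apply: gradedP => d /=; rewrite addNr. Qed.

HB.instance Definition _ :=
  GRing.isZmodule.Build graded gradedDA gradedDC gradedD0 gradedDN.

Let conv (f g : nat -> A) (d : nat) : A := \sum_(i < d.+1) f i * g (d - i)%N.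
Let rep (a : graded) (d : nat) : A := gr_repr (a d).

Let rep_filt a d : rep a d \in filt d. Proof. exact: gr_repr_filt. Qed.

Let conv_term_filt f g d (i : 'I_d.+1) :
  (forall e, f e \in filt e) -> (forall e, g e \in filt e) ->
  f i * g (d - i)%N \in filt d.
Proof.
move=> Ff Fg; have := filt_mul (Ff i) (Fg (d - i)%N).
by rewrite subnKC // -ltnS.
Qed.

Let conv_filt f g d :
  (forall e, f e \in filt e) -> (forall e, g e \in filt e) ->
  conv f g d \in filt d.
Proof. by move=> Ff Fg; apply: rpred_sum => i _; exact: conv_term_filt. Qed.

Let gradedM_conv (a b : graded) f g d :
  (forall e, f e \in filt e) -> (forall e, g e \in filt e) ->
  (forall e, a e = gr_class e (f e)) -> (forall e, b e = gr_class e (g e)) ->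
  gradedM a b d = gr_class d (conv f g d).
Proof.
move=> Ff Fg af bg; rewrite gr_class_sum => [|i]; last exact: conv_term_filt.
apply: eq_bigr => i _; rewrite af bg gr_mul_class // subnKC //.
by rewrite -ltnS.
Qed.

Let gradedM_rep (a b : graded) d :
  gradedM a b d = gr_class d (conv (rep a) (rep b) d).
Proof. by apply: gradedM_conv => // e; rewrite gr_reprK. Qed.

Let conv_rev f g d : conv f g d = \sum_(i < d.+1) f (d - i)%N * g i.
Proof.
rewrite /conv (reindex_inj rev_ord_inj); apply: eq_bigr => i _ /=.
by rewrite subSS subKn // -ltnS.
Qed.

Let convA f g h d : conv f (conv g h) d = conv (conv f g) h d.
Proof.
rewrite [RHS]conv_rev [LHS]/conv; pose F j k := f j * (g (d - j - k)%N * h k).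
transitivity (\sum_(j < d.+1) \sum_(k < d.+1 | (k <= d - j)%N) F j k).
  apply: eq_bigr => /= j _; rewrite conv_rev mulr_sumr.
  by rewrite (big_ord_narrow_leq (leq_subr _ _)).
rewrite (exchange_big_dep predT) //=; apply: eq_bigr => k _.
transitivity (\sum_(j < d.+1 | (j <= d - k)%N) F j k).
  apply: eq_bigl => j; rewrite -ltnS -(ltnS j) -!subSn ?leq_ord //.
  by rewrite -subn_gt0 -(subn_gt0 j) -!subnDA addnC.
rewrite (big_ord_narrow_leq (leq_subr _ _)) mulr_suml /=.
by apply: eq_bigr => j _; rewrite /F -!subnDA addnC mulrA.
Qed.

Lemma gradedMC : commutative gradedM.
Proof.
move=> a b; apply: gradedP => d; rewrite !gradedM_rep; congr (gr_class d _).
by rewrite conv_rev; apply: eq_bigr => i _; rewrite mulrC.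
Qed.

Lemma gradedMA : associative gradedM.
Proof.
move=> a b c; apply: gradedP => d.
transitivity (gr_class d (conv (rep a) (conv (rep b) (rep c)) d)).
  by apply: gradedM_conv => e; rewrite ?conv_filt ?gradedM_rep ?gr_reprK.
rewrite convA; apply/esym.
by apply: gradedM_conv => e; rewrite ?conv_filt ?gradedM_rep ?gr_reprK.
Qed.

Lemma gradedM1 : left_id (gr_in 0 1) gradedM.
Proof.
move=> a; apply: gradedP => d.
transitivity (gr_class d (conv (fun e => (e == 0%N)%:R) (rep a) d)).
  apply: gradedM_conv => e; rewrite ?gr_reprK ?rep_filt //.
    by case: e => [|e]; [exact: filt1|exact: rpred0].
  by case: e => [|e] //=; rewrite gr_class0.
rewrite /conv big_ord_recl /= subn0 mul1r big1 ?addr0 ?gr_reprK // => i _.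
by rewrite mul0r.
Qed.

Lemma gradedMD : left_distributive gradedM +%R.
Proof.
move=> a b c; apply: gradedP => d.
transitivity (gr_class d (conv (fun e => rep a e + rep b e) (rep c) d)).
  by apply: gradedM_conv => e; rewrite ?gr_reprK ?rpredD // gr_classD // !gr_reprK.
rewrite -[RHS]/(gradedM a c d + gradedM b c d) !gradedM_rep.
rewrite -gr_classD ?conv_filt //; congr (gr_class d _).
by rewrite /conv -big_split; apply: eq_bigr => i _; rewrite mulrDl.
Qed.

HB.instance Definition _ :=
  GRing.Zmodule_isComPzRing.Build graded gradedMA gradedMC gradedM1 gradedMD.

End AssociatedGraded.

(* x < y stands for le x y && (x != y).  The fuel size L bounds the length of
   every strictly increasing chain in L, so that this is the usual recursion
   mu(x, x) = 1 and mu(x, y) = - \sum_(x <= z < y) mu(x, z). *)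
Fixpoint mobius_rec (T : eqType) (L : seq T) (le : rel T) (k : nat) (x y : T) :
    int :=
  if x == y then 1 else
  if k is k'.+1 then
    - \sum_(z <- L | [&& le x z, le z y & z != y]) mobius_rec L le k' x z
  else 0.

Definition mobius (T : eqType) (L : seq T) (le : rel T) : T -> T -> int :=
  mobius_rec L le (size L).

Section Arrangement.
Variables (R : realType) (l n : nat).
Implicit Types (v : 'I_n -> 'rV[R]_l) (W J N : {set 'I_n}).

Definition dot (u x : 'rV[R]_l) : R := \sum_j u 0 j * x 0 j.

Definition hyperplane v (i : 'I_n) : {vspace 'rV[R]_l} :=
  lker (linfun (mulmxr (v i)^T)).

Lemma mem_hyperplane v i y : (y \in hyperplane v i) = (dot (v i) y == 0).
Proof.
rewrite memv_ker lfunE /=; apply/eqP/eqP => [/matrixP/(_ 0 0)|h].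
  by rewrite !mxE => <-; apply: eq_bigr => j _; rewrite mxE mulrC.
apply/matrixP => a b; rewrite !mxE -[RHS]h !ord1.
by apply: eq_bigr => j _; rewrite mxE mulrC.
Qed.

Definition halfspace v (i : 'I_n) : set 'rV[R]_l := [set y | 0 < dot (v i) y].

Definition cone v W : set 'rV[R]_l :=
  [set y | forall i, i \in W -> halfspace v i y].

Definition complement v : set 'rV[R]_l :=
  [set y | forall i, y \notin hyperplane v i].

Definition is_chamber v (C : set 'rV[R]_l) : Prop :=
  exists2 y, complement v y & C = connected_component (complement v) y.

Definition chambers v W : set (set 'rV[R]_l) :=
  [set C | is_chamber v C /\ C `<=` cone v W].

Definition VG v W : Type := set_type (chambers v W) -> int.
HB.instance Definition _ v W :=
  GRing.ComPzRing.copy (VG v W) (set_type (chambers v W) -> int).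

Definition heaviside v W (i : 'I_n) : VG v W :=
  fun C => if `[< val C `<=` halfspace v i >] then 1 else 0.

Arguments heaviside v W i : clear implicits.

Definition flat v J : {vspace 'rV[R]_l} := (\bigcap_(i in J) hyperplane v i)%VS.

Definition Lint v W : seq {vspace 'rV[R]_l} :=
  [seq X : {vspace 'rV[R]_l} <- undup [seq flat v J | J : {set 'I_n}] |
     `[< exists2 y, y \in X & cone v W y >]].

Definition Poin v W : {poly nat} :=
  \sum_(X <- Lint v W)
    'X^(l - \dim X) *+ `|mobius (Lint v W) (fun X Y => (Y <= X)%VS) fullv X|%N.

Definition signed_dependency v (D : {set 'I_n} * {set 'I_n}) : Prop :=
  exists lam : 'I_n -> R,
    [/\ \sum_i lam i *: v i = 0,
        D.1 = [set i | 0 < lam i]%SET & D.2 = [set i | lam i < 0]%SET].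

Definition usupp (D : {set 'I_n} * {set 'I_n}) : {set 'I_n} := D.1 :|: D.2.

Definition signed_circuit v (C : {set 'I_n} * {set 'I_n}) : Prop :=
  [/\ signed_dependency v C, usupp C != finset.set0 &
      forall D, signed_dependency v D -> usupp D != finset.set0 ->
        usupp D \subset usupp C -> usupp D = usupp C].

Definition broken_circuit v (B : {set 'I_n}) : Prop :=
  exists C (i : 'I_n),
    [/\ signed_circuit v C, i \in usupp C,
        forall j, j \in usupp C -> (i <= j)%N & B = usupp C :\ i].

Definition is_NBC v N : Prop := forall B, broken_circuit v B -> ~~ (B \subset N).

Definition NBC v W : {set {set 'I_n}} :=
  [set N | `[< is_NBC v N /\ flat v N \in Lint v W >]]%SET.

Definition NBC_poly v W : {poly nat} := \sum_(N in NBC v W) 'X^#|N|.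

(* The coefficients of p are the ranks of the graded pieces; stating it
   coefficientwise needs no a priori bound on the degree. *)
Definition is_Hilb v W (p : {poly nat}) : Prop :=
  forall d, has_Zrank (gr (heaviside v W) d) (p`_d)%R.

Definition emon J : {mpoly int[n]} := \prod_(i in J) 'X_i.

Inductive relations v W : {mpoly int[n]} -> Prop :=
| Idempotent i : relations v W ('X_i ^+ 2 - 'X_i)
| Unit i of i \in W : relations v W ('X_i - 1)
| ConeCircuitPos C of signed_circuit v C & W :&: C.1 != finset.set0
    & W :&: C.1 = W :&: usupp C :
    relations v W (emon (C.1 :\: W) * \prod_(j in C.2) ('X_j - 1))
| ConeCircuitNeg C of signed_circuit v C & W :&: C.2 != finset.set0
    & W :&: C.2 = W :&: usupp C :
    relations v W (emon (C.2 :\: W) * \prod_(j in C.1) ('X_j - 1))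
| Circuit C of signed_circuit v C & W :&: usupp C = finset.set0 :
    relations v W (emon C.1 * \prod_(j in C.2) ('X_j - 1)
                   - emon C.2 * \prod_(j in C.1) ('X_j - 1)).

Definition in_deg (p : {mpoly int[n]}) : {mpoly int[n]} :=
  pihomog mdeg (msize p).-1 p.

Definition monomial_order (le : rel 'X_{1..n}) : Prop :=
  [/\ total le, antisymmetric le, transitive le,
      forall m, le 0%MM m &
      forall m1 m2 m, le m1 m2 -> le (m1 + m)%MM (m2 + m)%MM].

Definition refines_degree (le : rel 'X_{1..n}) : Prop :=
  forall m1 m2, (mdeg m1 < mdeg m2)%N -> le m1 m2.

End Arrangement.

Arguments heaviside {R l n} v W i.

(* Main.v *)
Require Import Defs.
From HB Require Import structures.
From mathcomp Require Import mpoly.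
From mathcomp Require Import all_boot all_order all_algebra.
From mathcomp Require Import all_classical all_reals topology normedtype.
From mathcomp Require Import zify ring lra.

(** The monomials [e_N], [N] in [NBC v W], span the quotient by the initial
forms: a squarefree monomial [e_S] outside this set is, modulo the initial
forms, either zero (when [S] meets [W], or, by Farkas' lemma, when the flat of
[S] misses the cone) or a combination of monomials with a smaller sum of indices
(when [S] contains a broken circuit).  By induction on the degree they also
span the quotient by the relations.

They are independent in [VG v W] and in its associated graded ring.  Near a
point of the cone on the flat of [N], perturb successively in the directions dual to the
[v_a], [a] in [N], with both signs: the alternating sum of the values of a
function on the [2^#|N|] chambers so reached vanishes on products of fewer than
[#|N|] Heaviside functions, is [1] on [e_N], and vanishes on the other NBC
monomials of the same degree.  Hence both surjections are isomorphisms,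
without counting chambers.

Finally [mu(V, X)] is the sum of [(-1)^#|N|] over the NBC sets with flat [X]:
adding or removing the smallest index of a hyperplane containing [X] cancels the
NBC sets with flat above [X] in pairs. *)

Set Implicit Arguments.
Unset Strict Implicit.
Unset Printing Implicit Defensive.

Import Order.TTheory GRing.Theory Num.Theory numFieldNormedType.Exports.

Local Open Scope classical_set_scope.
Local Open Scope ring_scope.

(** The rewriting that lowers the sum of indices needs homogeneous relations in which the monomial
    to be removed has coefficient 1 or -1. This is why spanning is established for initial forms and
    then lifted: a relation differs from its initial form by terms of smaller degree. The delicate
    initial form is that of a circuit relation, whose two products share the same top form; after
    this cancellation it comes from their second coefficients.

    In the independence proof the powers of the perturbation parameter increase with the index.
    Hence the sign on which a normal depends is that of the smallest index in its expansion over
    [N], provided that neither the base point nor a direction inside the flat decides it first.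
    Smallest indices are what broken circuits are about, and this makes the functionals exactly dual
    to the NBC monomials within one degree. Since these functionals take the value 1, independence
    holds over the integers and torsion never has to be discussed.

    Farkas' lemma must deliver a circuit rather than an arbitrary dependency, because the relations
    are indexed by circuits; this requires an elimination that respects the signs on [W]. *)

(** * Signs of real polynomials near zero *)

Lemma horner_bounded_unit (R : realFieldType) (p : {poly R}) :
  exists2 M, 0 <= M & forall x, 0 < x <= 1 -> `|p.[x]| <= M.
Proof.
elim/poly_ind: p => [|p c [M M0 hM]].
  by exists 0 => // x _; rewrite horner0 normr0.
exists (M + `|c|); first by rewrite addr_ge0.
move=> x /[dup] /hM hx /andP[x0 x1]; rewrite hornerMXaddC.
rewrite (le_trans (ler_normD _ _)) // lerD2r normrM (gtr0_norm x0).
by rewrite -[M]mulr1 ler_pM // ltW.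
Qed.

Lemma horner_gt0_near0 (R : realFieldType) (p : {poly R}) k :
    (forall j, (j < k)%N -> p`_j = 0) -> 0 < p`_k ->
  exists2 e, 0 < e & forall x, 0 < x <= e -> 0 < p.[x].
Proof.
elim/poly_ind: p k => [|p c IH] k; first by rewrite coef0 ltxx.
have coE j : (p * 'X + c%:P)`_j = if j == 0%N then c else p`_j.-1.
  by rewrite coefD coefMX coefC; case: eqP => _; rewrite ?add0r ?addr0.
case: k => [_|k lt_k].
  rewrite coE /= => c0; have [M M0 hM] := horner_bounded_unit p.
  have M1 : 0 < M + 1 by rewrite ltr_pwDr.
  (* Since [x * p.[x] >= - x * M > - x * (M + 1)], the bound [x * (M + 1) <= c] suffices; adding 1
     to [M] makes the inequality strict and the denominator positive. *)
  exists (Num.min 1 (c / (M + 1))); first by rewrite lt_min ltr01 divr_gt0.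
  move=> x; rewrite le_min => /and3P[x0 x1 xc]; rewrite hornerMXaddC.
  have := hM x; rewrite x0 x1 => /(_ isT) /ler_normlP[hx _].
  have : c >= x * (M + 1) by rewrite -ler_pdivlMr.
  by nra.
rewrite coE /= => pk.
have c0 : c = 0 by have := lt_k 0%N isT; rewrite coE.
have [//|e e0 he] := IH k _ pk.
  by move=> j jk; have := lt_k j.+1 jk; rewrite coE.
exists e => // x /[dup] /he px /andP[x0 _].
by rewrite hornerMXaddC c0 addr0 mulr_gt0.
Qed.

(** It provides one parameter small enough for all hyperplanes at once; polynomials without a
    positive lowest coefficient impose no bound. *)
Lemma horner_gt0_near0_seq (R : realFieldType) (s : seq {poly R}) :
  exists2 e, 0 < e & forall x, 0 < x <= e -> forall p, p \in s ->
    forall k, (forall j, (j < k)%N -> p`_j = 0) -> 0 < p`_k -> 0 < p.[x].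
Proof.
elim: s => [|p s [e e0 he]]; first by exists 1.
have [[k [lt_k pk]]|no_k] := pselect (exists k,
    (forall j, (j < k)%N -> p`_j = 0) /\ 0 < p`_k).
  have [e' e'0 he'] := horner_gt0_near0 lt_k pk.
  exists (Num.min e e'); first by rewrite lt_min e0.
  move=> x; rewrite le_min => /and3P[x0 xe xe'] q.
  rewrite inE => /predU1P[-> _ _ _|]; first by apply: he'; rewrite x0.
  by apply: he; rewrite x0.
exists e => // x xe q; rewrite inE => /predU1P[-> k lt_k pk|]; last exact: he.
by case: no_k; exists k.
Qed.

(** * Normals, spans and dimensions of flats *)

Section LinearAlgebra.
Variables (R : realType) (l n : nat) (v : 'I_n -> 'rV[R]_l).
Implicit Types (S T N W : {set 'I_n}) (lam : 'I_n -> R) (x y : 'rV[R]_l).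

Lemma dotE x y : dot x y = (x *m y^T) 0 0.
Proof. by rewrite mxE; apply: eq_bigr => j _; rewrite mxE. Qed.

Lemma dotC x y : dot x y = dot y x.
Proof. by apply: eq_bigr => j _; rewrite mulrC. Qed.

Lemma dotDr x y z : dot x (y + z) = dot x y + dot x z.
Proof. by rewrite -big_split; apply: eq_bigr => j _; rewrite mxE mulrDr. Qed.

Lemma dotZr x c y : dot x (c *: y) = c * dot x y.
Proof. by rewrite mulr_sumr; apply: eq_bigr => j _; rewrite mxE mulrCA. Qed.

Lemma dot0r x : dot x 0 = 0.
Proof. by rewrite -(scale0r 0) dotZr mul0r. Qed.

Lemma dot_sumr x (I : Type) (r : seq I) (P : pred I) (F : I -> 'rV[R]_l) :
  dot x (\sum_(i <- r | P i) F i) = \sum_(i <- r | P i) dot x (F i).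
Proof. by elim/big_rec2: _ => [|i a b _ <-]; rewrite ?dot0r ?dotDr. Qed.

Lemma dot_suml (P : pred 'I_n) lam y :
  dot (\sum_(i | P i) lam i *: v i) y = \sum_(i | P i) lam i * dot (v i) y.
Proof.
by rewrite dotC dot_sumr; apply: eq_bigr => i _; rewrite dotZr dotC.
Qed.

Lemma flatP S y :
  reflect (forall i, i \in S -> dot (v i) y = 0) (y \in flat v S).
Proof.
rewrite memvE; apply: (iffP subv_bigcapP) => h i iS.
  by apply/eqP; rewrite -mem_hyperplane memvE h.
by rewrite -memvE mem_hyperplane h.
Qed.

Lemma flat0 : flat v finset.set0 = fullv.
Proof. by rewrite /flat big_set0. Qed.

Lemma flat_hyperplane S i : i \in S -> (flat v S <= hyperplane v i)%VS.
Proof.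
by move=> iS; apply/subvP => y /flatP/(_ i iS) h; rewrite mem_hyperplane h.
Qed.

Definition in_span S x := exists lam, x = \sum_(i in S) lam i *: v i.

Lemma in_span_gen S i : i \in S -> in_span S (v i).
Proof.
move=> iS; exists (fun j => (j == i)%:R); rewrite (bigD1 i) //= eqxx scale1r.
by rewrite big1 ?addr0 // => j /andP[_ /negPf->]; rewrite scale0r.
Qed.

Lemma in_spanD S x y :
  in_span S x -> in_span S y -> in_span S (x + y).
Proof.
move=> [c ->] [d ->]; exists (fun i => c i + d i); rewrite -big_split.
by apply: eq_bigr => i _; rewrite scalerDl.
Qed.

Lemma in_spanZ S c x : in_span S x -> in_span S (c *: x).
Proof.
move=> [d ->]; exists (fun i => c * d i); rewrite scaler_sumr.
by apply: eq_bigr => i _; rewrite scalerA.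
Qed.

Lemma in_span_comb S T lam :
  (forall i, i \in S -> lam i != 0 -> in_span T (v i)) ->
  in_span T (\sum_(i in S) lam i *: v i).
Proof.
move=> h; elim/big_rec: _ => [|i x iS].
  by exists (fun=> 0); rewrite big1 // => i _; rewrite scale0r.
have [->|/(h i iS) vi] := eqVneq (lam i) 0; first by rewrite scale0r add0r.
by apply: in_spanD; exact: in_spanZ.
Qed.

(** Double annihilator: the columns of the cokernel of the matrix of normals in [S] are points of
    the flat, so a normal vanishing on the flat kills the cokernel and lies in the row space. *)
Lemma flat_sub_hyperplane S i :
  (flat v S <= hyperplane v i)%VS -> in_span S (v i).
Proof.
pose M : 'M[R]_(n, l) := \matrix_j (if j \in S then v j else 0).
move=> /subvP h; suff : (v i <= M)%MS.
  move=> /submxP[D ->]; exists (D 0); rewrite mulmx_sum_row [RHS]big_mkcond.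
  by apply: eq_bigr => j _; rewrite rowK; case: ifP => //; rewrite scaler0.
rewrite submxE; apply/eqP/matrixP => a b; rewrite ord1 [RHS]mxE.
pose y := (col b (cokermx M))^T.
have dotM (u : 'rV_l) : dot u y = (u *m cokermx M) 0 b.
  by rewrite dotE trmxK !mxE; apply: eq_bigr => j _; rewrite mxE.
rewrite -dotM; apply/eqP; rewrite -mem_hyperplane h //; apply/flatP => j jS.
have -> : v j = row j M by rewrite rowK jS.
by rewrite dotM -row_mul mulmx_coker !mxE.
Qed.

Definition indep S :=
  forall lam, \sum_(i in S) lam i *: v i = 0 -> forall i, i \in S -> lam i = 0.

Lemma indep_span S i : indep S -> i \in S -> ~ in_span (S :\ i) (v i).
Proof.
move=> indS iS [lam vi].
suff /indS/(_ i iS)/eqP : \sum_(j in S) (if j == i then -1 else lam j) *: v j = 0.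
  by rewrite eqxx oppr_eq0 oner_eq0.
rewrite (big_setD1 i iS) /= eqxx scaleN1r [in X in X + _]vi addrC; apply/eqP.
rewrite subr_eq0; apply/eqP; apply: eq_bigr => j; rewrite !inE => /andP[/negPf->//].
Qed.

(** Each further independent normal restricts to a nonzero linear form on the previous flat and
    lowers its dimension by exactly one. *)
Lemma dim_flat S : indep S -> (\dim (flat v S) + #|S|)%N = l.
Proof.
have [k] := ubnP #|S|; elim: k S => // k IH S ltS indS.
have [->|[i iS]] := set_0Vmem S.
  by rewrite flat0 cards0 addn0 dimvf /dim /= mul1n.
have indS' : indep (S :\ i).
  move=> lam h j; rewrite !inE => /andP[ji jS].
  suff /indS/(_ j jS) : \sum_(j in S) (if j == i then 0 else lam j) *: v j = 0.
    by rewrite (negPf ji).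
  rewrite (big_setD1 i iS) /= eqxx scale0r add0r -[RHS]h.
  by apply: eq_bigr => m; rewrite !inE => /andP[/negPf->].
have cS : #|S| = (#|S :\ i|).+1 by rewrite (cardsD1 i S) iS.
have := IH (S :\ i); rewrite -ltnS -cS => /(_ ltS indS') dimS.
rewrite -[RHS]dimS cS addnS -addSn; congr (_ + _)%N.
have -> : flat v S = (flat v (S :\ i) :&: hyperplane v i)%VS.
  by rewrite /flat (big_setD1 i iS) capvC.
set U := flat v _; rewrite /hyperplane; set f := linfun _.
rewrite -[RHS](limg_ker_dim f U) -[LHS]addn1; congr (_ + _)%N; apply/esym/eqP.
rewrite eqn_leq; apply/andP; split.
  by rewrite (leq_trans (dimvS (subvf _))) // dimvf /dim /= mul1n.
rewrite lt0n dimv_eq0; apply/negP => /eqP fU.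
apply: (indep_span indS iS); apply: flat_sub_hyperplane; apply/subvP => y yU.
by rewrite memv_ker -/f -memv0 -fU memv_img.
Qed.

Lemma dual_vector S i : indep S -> i \in S ->
  exists2 u, dot (v i) u = 1 & forall j, j \in S -> j != i -> dot (v j) u = 0.
Proof.
move=> indS iS; have : ~ (flat v (S :\ i) <= hyperplane v i)%VS.
  by move/flat_sub_hyperplane; exact: indep_span.
move=> /negP/subvPn[y /flatP yS]; rewrite mem_hyperplane => viy.
exists ((dot (v i) y)^-1 *: y); first by rewrite dotZr mulVf.
by move=> j jS ji; rewrite dotZr (yS j) ?mulr0 // in_setD1 ji.
Qed.

(** * Circuits, Farkas' lemma and NBC sets *)

Definition supp lam := [set i | lam i != 0]%SET.

Definition sdep lam := ([set i | 0 < lam i]%SET, [set i | lam i < 0]%SET).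

Lemma usupp_sdep lam : usupp (sdep lam) = supp lam.
Proof. by apply/setP => i; rewrite !inE orbC -neq_lt. Qed.

Lemma sdep_dependency lam : \sum_i lam i *: v i = 0 ->
  signed_dependency v (sdep lam).
Proof. by exists lam. Qed.

Lemma circuit_dependency C : signed_circuit v C ->
  exists2 lam, \sum_i lam i *: v i = 0 & C = sdep lam.
Proof.
case=> -[lam [lam0 h1 h2]] _ _; exists lam => //.
by rewrite [C]surjective_pairing h1 h2.
Qed.

Lemma not_circuit lam : \sum_i lam i *: v i = 0 -> supp lam != finset.set0 ->
  ~ signed_circuit v (sdep lam) ->
  exists mu, [/\ \sum_i mu i *: v i = 0, supp mu != finset.set0 &
                supp mu \proper supp lam].
Proof.
move=> lam0 slam nC; apply: contrapT => no_mu; apply: nC.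
split; [exact: sdep_dependency|by rewrite usupp_sdep|].
move=> D [mu [mu0 D1 D2]].
have -> : D = sdep mu by rewrite [D]surjective_pairing D1 D2.
rewrite !usupp_sdep => smu sub; apply/eqP; rewrite finset.eqEsubset sub /=.
by apply: contra_notT no_mu => nsub; exists mu; split => //; rewrite properE sub.
Qed.

Lemma circuit_in_support lam :
    \sum_i lam i *: v i = 0 -> supp lam != finset.set0 ->
  exists2 C, signed_circuit v C & usupp C \subset supp lam.
Proof.
have [k] := ubnP #|supp lam|; elim: k lam => // k IH lam ltk lam0 slam.
have [?|/(not_circuit lam0 slam)] := pselect (signed_circuit v (sdep lam)).
  by exists (sdep lam); rewrite ?usupp_sdep.
case=> mu [mu0 smu pmu]; have [|C Cc sC] := IH mu _ mu0 smu.
  exact: leq_trans (proper_card pmu) ltk.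
by exists C => //; rewrite (fintype.subset_trans sC) // proper_sub.
Qed.

(** Elimination step: clearing coordinate [i] with a multiple of [mu] creates no coordinate outside
    the support of [lam]. *)
Lemma supp_shift lam mu (t : R) i : supp mu \proper supp lam ->
  mu i != 0 -> lam i - t * mu i = 0 ->
  (#|supp (fun j => (lam j - t * mu j)%R)| < #|supp lam|)%N.
Proof.
move=> /proper_sub/fintype.subsetP sub mui li; apply: proper_card; apply/properP; split.
  apply/fintype.subsetP => j; rewrite !inE; apply: contraNneq => lj.
  have := sub j; rewrite !inE lj eqxx.
  by case: eqP => [->|_ /(_ isT)//]; rewrite mulr0 subr0.
exists i; first by apply: sub; rewrite inE.
by rewrite inE li eqxx.
Qed.

Lemma sum_shift lam mu (t : R) : \sum_i lam i *: v i = 0 ->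
  \sum_i mu i *: v i = 0 -> \sum_i (lam i - t * mu i) *: v i = 0.
Proof.
move=> l0 m0; under eq_bigr do rewrite scalerBl -scalerA.
by rewrite sumrB -scaler_sumr l0 m0 scaler0 subr0.
Qed.

(** A certificate that the flat of [S] misses the cone: paired with a common point it would express
    zero as a sum of nonnegative terms, one of them positive. Signs off [W] are free because those
    normals vanish on the flat. *)
Definition cone_dependency S W lam :=
  [/\ \sum_i lam i *: v i = 0, supp lam \subset S :|: W,
      forall w, w \in W -> 0 <= lam w & exists2 w, w \in W & 0 < lam w].

(* A dependency of minimal support among those that are nonnegative and nonzero
   on W is a circuit: otherwise a smaller dependency can be used to cancel one
   of its coordinates without leaving this set. *)
Lemma cone_dependency_circuit S W lam : cone_dependency S W lam ->
  exists C, [/\ signed_circuit v C, usupp C \subset S :|: W,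
    W :&: C.1 != finset.set0 & W :&: C.1 = W :&: usupp C].
Proof.
have [k] := ubnP #|supp lam|; elim: k lam => // k IH lam ltk [lam0 slam posl [w wW lw]].
have suppl : supp lam != finset.set0 by apply/set0Pn; exists w; rewrite inE gt_eqF.
have [Cc|/(not_circuit lam0 suppl)] := pselect (signed_circuit v (sdep lam)).
  exists (sdep lam); split; rewrite ?usupp_sdep //.
    by apply/set0Pn; exists w; rewrite !inE wW.
  apply/setP => i; rewrite !inE; case: (boolP (i \in W)) => //= /posl.
  by rewrite le0r; case: eqP => [->|_]; rewrite ?ltxx.
move=> [mu0 [mu0_dep smu0 pmu0]].
(* Up to replacing [mu0] by its opposite, the smaller dependency is either positive somewhere on [W]
   or zero on all of [W]. *)
suff step mu : \sum_i mu i *: v i = 0 -> supp mu \proper supp lam ->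
    (exists2 i, i \in W & 0 < mu i) \/ (exists2 i, mu i != 0 &
      forall w, w \in W -> mu w = 0) ->
    exists2 nu, cone_dependency S W nu & (#|supp nu| < #|supp lam|)%N.
  have [nu cnu ltnu] : exists2 nu, cone_dependency S W nu & (#|supp nu| < #|supp lam|)%N.
    have [[i iW mui]|no_pos] := pselect (exists2 i, i \in W & 0 < mu0 i).
      by apply: (step mu0) => //; left; exists i.
    have [[i iW mui]|no_neg] := pselect (exists2 i, i \in W & mu0 i < 0).
      apply: (step (fun i => - mu0 i)).
      - by under eq_bigr do rewrite scaleNr; rewrite sumrN mu0_dep oppr0.
      - suff -> : supp (fun i => - mu0 i) = supp mu0 by [].
        by apply/setP => j; rewrite !inE oppr_eq0.
      - by left; exists i; rewrite ?oppr_gt0.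
    apply: (step mu0) => //; right; case/set0Pn: smu0 => i; rewrite inE => mui.
    exists i => // j jW; apply/eqP; case: ltgtP => // h.
      by case: no_neg; exists j.
    by case: no_pos; exists j.
  exact: IH (leq_trans ltnu ltk) cnu.
move=> mudep pmu [[i0 i0W mui0]|[i mui muW]].
  (* Ratio test: the minimum of [lam i / mu i] over positive [mu i] is the largest multiple of [mu]
     whose subtraction keeps the coordinates on [W] nonnegative. *)
  pose P := [pred i | (i \in W) && (0 < mu i)].
  have Pi0 : P i0 by rewrite /= i0W.
  case: (arg_minP (fun i => lam i / mu i) Pi0) => i /andP[iW mui] imin.
  pose t := lam i / mu i; have t0 : 0 <= t by rewrite divr_ge0 ?posl // ltW.
  pose nu j := lam j - t * mu j.
  have nui : nu i = 0 by rewrite /nu /t divfK ?subrr // gt_eqF.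
  have nu0 : \sum_i nu i *: v i = 0 by exact: sum_shift.
  have cnu : (#|supp nu| < #|supp lam|)%N by apply: (@supp_shift _ _ _ i) => //; rewrite gt_eqF.
  have nupos j : j \in W -> 0 <= nu j.
    move=> jW; rewrite subr_ge0; have [muj|muj] := ltP 0 (mu j).
      by rewrite -ler_pdivlMr //; apply: imin; rewrite /= jW.
    by rewrite (@le_trans _ _ 0) ?posl // mulr_ge0_le0.
  have sub_supp : supp nu \subset S :|: W.
    apply: fintype.subset_trans slam; apply/fintype.subsetP => j.
    rewrite !inE; apply: contraNneq => lj.
    have := proper_sub pmu; move/fintype.subsetP/(_ j); rewrite !inE lj eqxx /nu lj.
    by case: eqP => [->|_ /(_ isT)//]; rewrite mulr0 subr0.
  have [[j jW nuj]|no_pos] := pselect (exists2 j, j \in W & 0 < nu j).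
    by exists nu => //; split => //; exists j.
  (* If nothing positive is left on [W], then [lam] equals [t * mu] there, with [t] positive, and
     [mu] itself is a certificate of smaller support. *)
  have lamE j : j \in W -> lam j = t * mu j.
    move=> jW; apply/eqP; rewrite -subr_eq0; have := nupos j jW.
    by rewrite le0r => /orP[//|h]; case: no_pos; exists j.
  have {}t0 : 0 < t.
    by rewrite lt0r t0 andbT; apply: contraTneq lw => t0'; rewrite lamE // t0' mul0r ltxx.
  exists mu; last exact: proper_card.
  split=> //; [exact: fintype.subset_trans (proper_sub pmu) slam| |by exists i].
  by move=> j jW; have := posl j jW; rewrite lamE // pmulr_rge0.
(* Here [mu] vanishes on [W], so the coordinate can be cleared without touching the conditions on
   [W]. *)
pose t := lam i / mu i; pose nu j := lam j - t * mu j.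
have nuW j : j \in W -> nu j = lam j by move=> jW; rewrite /nu muW // mulr0 subr0.
exists nu; last by apply: (@supp_shift _ _ _ i); rewrite // /t divfK ?subrr.
split; [exact: sum_shift| |by move=> j jW; rewrite nuW ?posl|by exists w; rewrite ?nuW].
apply: fintype.subset_trans slam; apply/fintype.subsetP => j; rewrite !inE; apply: contraNneq => lj.
have := proper_sub pmu; move/fintype.subsetP/(_ j); rewrite !inE lj eqxx /nu lj.
by case: eqP => [->|_ /(_ isT)//]; rewrite mulr0 subr0.
Qed.

(** Induction on [W]: without [w] there is a point [x], and only [dot (v w) x <= 0] is an obstacle.
    Moving [w] into [S] then gives a certificate, or a point of the hyperplane of [w]. Such a point
    can be pushed to the positive side unless [v w] lies in the span of [S], which is again a
    certificate. *)
Lemma farkas S W : S :&: W = finset.set0 ->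
  (exists2 y, y \in flat v S & cone v W y) \/ exists lam, cone_dependency S W lam.
Proof.
have [k] := ubnP #|W|; elim: k S W => // k IH S W ltk disSW.
have [->|[w wW]] := set_0Vmem W.
  by left; exists 0; [exact: mem0v|move=> i; rewrite inE].
pose W' := W :\ w.
have ltk' : (#|W'| < k)%N by move: ltk; rewrite (cardsD1 w W) wW ltnS.
have disj i : i \in W -> i \in S = false.
  by move=> iW; apply/negP => iS; have := finset.in_set0 i; rewrite -disSW inE iS iW.
have wS : w \notin S by rewrite disj.
have disSW' : S :&: W' = finset.set0.
  by apply/setP => i; rewrite !inE; case: (boolP (i \in W)) => [/disj->|]; rewrite ?andbF.
have disS'W' : (w |: S) :&: W' = finset.set0.
  apply/setP => i; have := finset.in_set0 i; rewrite -disSW' !inE.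
  by case: eqP => //= _; rewrite andbF.
have WE i : i \in W -> i = w \/ i \in W'.
  by rewrite !inE => ->; case: eqP => [->|]; [left|right].
have [[x xS xW']|[lam [lam0 slam posl [i iW' li]]]] := IH S W' ltk' disSW'; last first.
  right; have lamw : lam w = 0.
    apply/eqP; have := fintype.subsetP slam w; rewrite !inE eqxx (negPf wS) /=.
    by case: eqP => // _ /(_ isT).
  exists lam; split=> //; last by exists i => //; move: iW'; rewrite !inE => /andP[].
    by rewrite (fintype.subset_trans slam) // finset.setUS // subD1set.
  by move=> j /WE[->|/posl//]; rewrite lamw.
have [vwx|vwx] := ltP 0 (dot (v w) x).
  by left; exists x => // i /WE[->//|/xW'].
have [[y yS yW']|[lam [lam0 slam posl [i iW' li]]]] := IH (w |: S) W' ltk' disS'W'.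
  have [/flat_sub_hyperplane[mu vw]|] := boolP (flat v S <= hyperplane v w)%VS.
    right; exists (fun j => if j == w then 1 else if j \in S then - mu j else 0).
    split.
    - rewrite (bigD1 w) //= eqxx scale1r [in X in X + _]vw big_mkcond /= [X in _ + X]big_mkcond.
      rewrite -big_split big1 //= => j _.
      case: eqP => [->|_] /=; first by rewrite (negPf wS) addr0.
      by case: ifP => _; rewrite ?scaleNr ?subrr // scale0r addr0.
    - apply/fintype.subsetP => j; rewrite !inE; have [->|_] := eqVneq j w; first by rewrite wW orbT.
      by case: ifP => // _; rewrite eqxx.
    - move=> j jW; case: eqP => // _.
      by rewrite disj.
    - by exists w; rewrite ?eqxx.
  move=> /subvPn[z zS]; rewrite mem_hyperplane => vwz.
  (* The scaling turns [dot (v w) z'] into a nonzero square, hence a positive number. *)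
  left; pose z' := (dot (v w) z) *: z.
  have [e e0 he] := horner_gt0_near0_seq
    [seq (dot (v i) z')%:P * 'X + (dot (v i) y)%:P | i <- enum 'I_n].
  exists (y + e *: z').
    apply/flatP => j jS; rewrite dotDr !dotZr (flatP _ _ zS j jS) !mulr0 addr0.
    by apply: (flatP _ _ yS); rewrite !inE jS orbT.
  have vwy : dot (v w) y = 0 by apply: (flatP _ _ yS); rewrite !inE eqxx.
  move=> j /WE[->|jW'].
    by rewrite /halfspace /= dotDr vwy add0r !dotZr mulr_gt0 // -expr2 exprn_even_gt0.
  have := he e; rewrite e0 lexx => /(_ isT) /(_ _ (map_f _ (mem_enum _ j))).
  move=> /(_ 0%N); rewrite hornerMXaddC hornerC coefD coefMX !coefC /= add0r.
  move=> pos; rewrite /halfspace /= dotDr dotZr addrC mulrC; apply: pos => //.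
  exact: yW'.
(* The certificate for [w |: S] leaves the sign at [w] open. Pairing with [x] settles it: the terms
   on [W'] have a positive sum and [dot (v w) x <= 0]. *)
right; exists lam; have lw : 0 < lam w.
  have : dot (\sum_i lam i *: v i) x = 0 by rewrite lam0 dotC dot0r.
  rewrite dot_suml (bigD1 w) //= (bigID (mem W')) /= [X in _ + (_ + X)]big1; last first.
    move=> j /andP[jw jW']; have [jS|jS] := boolP (j \in S).
      by rewrite (flatP _ _ xS) ?mulr0.
    suff /eqP-> : lam j == 0 by rewrite mul0r.
    apply: contraNT jS => lj; have := fintype.subsetP slam j; rewrite inE lj.
    by move=> /(_ isT); rewrite !inE (negPf jw) /= => /orP[//|jW]; move: jW'; rewrite !inE jw jW.
  rewrite addr0 => sum0.
  have spos : 0 < \sum_(j | (j != w) && (j \in W')) lam j * dot (v j) x.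
    have iw : i != w by move: iW'; rewrite !inE => /andP[].
    rewrite (bigD1 i) ?iw //= ltr_pwDl ?mulr_gt0 //; first exact: xW'.
    apply: sumr_ge0 => j /andP[/andP[_ jW'] _]; rewrite mulr_ge0 ?posl // ltW //; exact: xW'.
  rewrite ltNge; apply/negP => lw0.
  by have := mulr_le0 lw0 vwx; lra.
split=> //; last by exists w.
  apply: fintype.subset_trans slam _; apply/fintype.subsetP => j; rewrite !inE.
  by case: eqP => [->|_] /=; rewrite ?wW ?orbT.
by move=> j /WE[->|/posl//]; exact: ltW.
Qed.


Lemma circuit_span C i : signed_circuit v C -> i \in usupp C ->
  in_span (usupp C :\ i) (v i).
Proof.
move=> /circuit_dependency[lam lam0 ->]; rewrite usupp_sdep inE => li.
exists (fun j => - (lam i)^-1 * lam j).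
under eq_bigr do rewrite -scalerA; rewrite -scaler_sumr.
move: lam0; rewrite (bigD1 i) //= => /eqP; rewrite addr_eq0 => /eqP h.
have -> : \sum_(j in supp lam :\ i) lam j *: v j = - (lam i *: v i).
  rewrite h opprK big_mkcond [RHS]big_mkcond; apply: eq_bigr => j _.
  rewrite !inE; case: eqP => //= _; case: eqP => //= ->.
  by rewrite scale0r.
by rewrite scalerN scaleNr opprK scalerA mulVf // scale1r.
Qed.

Lemma circuit_min C : signed_circuit v C -> exists2 i, i \in usupp C &
  forall j, j \in usupp C -> (i <= j)%N.
Proof.
case=> _ /set0Pn[i0 i0C] _.
by case: (arg_minnP (fun i : 'I_n => i : nat) i0C) => i iC imin; exists i.
Qed.

Lemma NBC_sub S N : S \subset N -> is_NBC v N -> is_NBC v S.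
Proof.
by move=> SN nbc B /nbc; apply: contra => /fintype.subset_trans; apply.
Qed.

Lemma NBC_no_circuit N C : is_NBC v N -> signed_circuit v C ->
  ~~ (usupp C \subset N).
Proof.
move=> nbc Cc; have [i iC imin] := circuit_min Cc.
have : broken_circuit v (usupp C :\ i) by exists C, i.
by move=> /nbc; apply: contra; apply: fintype.subset_trans; exact: subD1set.
Qed.

Lemma NBC_indep N : is_NBC v N -> indep N.
Proof.
move=> nbc lam lam0 i iN; apply: contrapT => /eqP li.
pose mu j := if j \in N then lam j else 0.
have mu0 : \sum_j mu j *: v j = 0.
  rewrite -[RHS]lam0 [RHS]big_mkcond; apply: eq_bigr => j _.
  by rewrite /mu; case: ifP => //; rewrite scale0r.
have [|C Cc sC] := circuit_in_support mu0.
  by apply/set0Pn; exists i; rewrite inE /mu iN.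
apply/negP: (NBC_no_circuit nbc Cc); apply/negPn; apply: fintype.subset_trans sC _.
by apply/fintype.subsetP => j; rewrite inE /mu; case: ifP => //; rewrite eqxx.
Qed.

(** A circuit in the support of such a relation either avoids [i] and lies in [N], or has minimum
    [i], and then the rest of it is a broken circuit in [N]. The index [i] may lie outside [N], and
    is used so. *)
Lemma NBC_notin_span N (i : 'I_n) : is_NBC v N ->
  ~ in_span [set j in N | (i < j)%N]%SET (v i).
Proof.
move=> nbc [lam vi]; pose B := [set j in N | (i < j)%N]%SET.
pose mu j := if j == i then -1 else if j \in B then lam j else 0.
have iB : i \notin B by rewrite inE ltnn andbF.
have mu0 : \sum_j mu j *: v j = 0.
  rewrite (bigD1 i) //= {1}/mu eqxx scaleN1r [in X in X + _]vi addrC.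
  apply/eqP; rewrite subr_eq0; apply/eqP.
  rewrite big_mkcond [RHS]big_mkcond; apply: eq_bigr => j _.
  rewrite /mu; case: eqP => [->|_] /=; first by rewrite -/B (negPf iB).
  by rewrite -/B; case: ifP => //; rewrite scale0r.
have [|C Cc sC] := circuit_in_support mu0.
  by apply/set0Pn; exists i; rewrite inE /mu eqxx oppr_eq0 oner_eq0.
have subC j : j \in usupp C -> j != i -> j \in B.
  move=> /(fintype.subsetP sC); rewrite inE /mu => + /negPf ji; rewrite ji.
  by case: (boolP (j \in B)) => // _; rewrite eqxx.
have [iC|iC] := boolP (i \in usupp C); last first.
  apply/negP: (NBC_no_circuit nbc Cc); apply/negPn; apply/fintype.subsetP => j jC.
  have := subC j jC; rewrite inE => /(_ _)/andP[]// .
  by apply: contraNneq iC => <-.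
have : broken_circuit v (usupp C :\ i).
  exists C, i; split=> // j jC; have [->//|/(subC j jC)] := eqVneq j i.
  by rewrite inE => /andP[_ /ltnW].
move=> /nbc/negP; apply; apply/fintype.subsetP => j; rewrite in_setD1 => /andP[ji jC].
by have := subC j jC ji; rewrite inE => /andP[].
Qed.

Lemma LintP W S : reflect (exists2 y, y \in flat v S & cone v W y)
                          (flat v S \in Lint v W).
Proof.
rewrite mem_filter mem_undup map_f ?andbT; last by rewrite mem_enum.
exact: asboolP.
Qed.

Lemma NBCP W S : reflect (is_NBC v S /\ exists2 y, y \in flat v S & cone v W y)
                         (S \in NBC v W).
Proof.
rewrite inE; apply: (iffP (asboolP _)) => -[nbc h]; split=> //; exact/LintP.
Qed.

(* The three ways a monomial [e_S] is the leading term of a relation. *)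
Lemma not_NBC W S : S :&: W = finset.set0 -> S \notin NBC v W ->
  exists2 C, signed_circuit v C &
   [\/ [/\ W :&: C.1 != finset.set0, W :&: C.1 = W :&: usupp C
         & usupp C :\: W \subset S],
       [/\ W :&: C.2 != finset.set0, W :&: C.2 = W :&: usupp C
         & usupp C :\: W \subset S] |
       W :&: usupp C = finset.set0 /\ exists i,
         [/\ i \in usupp C, forall j, j \in usupp C -> (i <= j)%N
           & usupp C :\ i \subset S]].
Proof.
move=> disSW nS; have [|[lam /cone_dependency_circuit]] := farkas disSW; last first.
  move=> [C [Cc subC neq0 CW]]; exists C => //; constructor 1; split => //.
  by rewrite subDset finset.setUC.
move=> meets; have : ~ is_NBC v S by move=> nbc; move/NBCP: nS; apply.
move=> /existsNP[B /not_implyP[[C [i [Cc iC imin ->]]] /negP]]; rewrite negbK => CS.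
have disj j : j \in S -> j \in W = false.
  by move=> jS; apply/negP => jW; have := finset.in_set0 j; rewrite -disSW inE jS jW.
exists C => //.
(* As [S] avoids [W], the circuit can meet [W] only in its minimum [i]; whether it does, and the
   sign of [i] in it, select the case. *)
have CW j : j \in usupp C -> j \in W -> j = i.
  move=> jC jW; apply: contraTeq jW => ji.
  by rewrite disj // (fintype.subsetP CS) // in_setD1 ji.
have [iW|iW] := boolP (i \in W); last first.
  constructor 3; split; last by exists i.
  apply/setP => j; rewrite inE [RHS]inE; apply/negP => /andP[jW jC].
  by move: iW; rewrite -(CW j jC jW) jW.
have CWS : usupp C :\: W \subset S.
  apply/fintype.subsetP => j; rewrite inE => /andP[jW jC].
  by rewrite (fintype.subsetP CS) // in_setD1 jC andbT; apply: contraNneq jW => ->.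
move: iC; rewrite inE => /orP[] iC; [constructor 1|constructor 2]; split=> //.
- by apply/set0Pn; exists i; rewrite inE iW.
- apply/setP => j; rewrite !inE; case: (boolP (j \in W)) => //= jW.
  apply/idP/idP => [->//|h]; first by rewrite (CW j) // inE.
- by apply/set0Pn; exists i; rewrite inE iW.
apply/setP => j; rewrite !inE; case: (boolP (j \in W)) => //= jW.
apply/idP/idP => [->|h]; first by rewrite orbT.
by rewrite (CW j) // inE.
Qed.

End LinearAlgebra.

(** * Ring morphisms out of a quotient *)

Section QuotientLift.
Variables (A B : comPzRingType) (G : set A) (phi : {rmorphism A -> B}).

Lemma qclass_surj (q : quot_ring G) : exists a, qclass G a = q.
Proof. by exists (repr q); exact: qclassK. Qed.

Definition qlift (q : quot_ring G) : B := phi (sval (cid (qclass_surj q))).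

Hypothesis phiG : forall g, G g -> phi g = 0.

Lemma qliftE a : qlift (qclass G a) = phi a.
Proof.
rewrite /qlift; case: cid => b /= /qclassE /asboolP[s [Gs]] /eqP.
rewrite subr_eq => /eqP ->; rewrite rmorphD rmorph_sum big_seq big1 ?add0r //.
by move=> p /Gs/phiG h; rewrite rmorphM h mulr0.
Qed.

Lemma qlift_rmorphism :
  exists f : {rmorphism quot_ring G -> B}, forall a, f (qclass G a) = phi a.
Proof.
have qN a : - qclass G a = qclass G (- a).
  by apply/eqP; rewrite eq_sym -addr_eq0 -qclassD addNr; apply/eqP;
     apply: (addrI (qclass G 0)); rewrite -qclassD !addr0.
have add : zmod_morphism qlift.
  move=> x y; have [[a <-] [b <-]] := (qclass_surj x, qclass_surj y).
  by rewrite qN -qclassD !qliftE rmorphB.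
have mul : monoid_morphism qlift.
  split; first by rewrite -[LHS]/(qlift (qclass G 1)) qliftE rmorph1.
  move=> x y; have [[a <-] [b <-]] := (qclass_surj x, qclass_surj y).
  by rewrite -[_ * _]/(qmul _ _) -qclassM !qliftE rmorphM.
exists (HB.pack_for {rmorphism quot_ring G -> B} qlift
  (GRing.isZmodMorphism.Build _ _ qlift add)
  (GRing.isMonoidMorphism.Build _ _ qlift mul)) => a.
exact: qliftE.
Qed.

End QuotientLift.

(** * Evaluation of integer polynomials *)

(** The variables of [m] with multiplicity, since [filt] counts the factors of products over
    sequences. *)
Definition mon_seq n (m : 'X_{1..n}) : seq 'I_n :=
  flatten [seq nseq (m i) i | i <- index_enum 'I_n].

Lemma size_mon_seq n (m : 'X_{1..n}) : size (mon_seq m) = mdeg m.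
Proof.
rewrite size_flatten /shape -map_comp sumnE big_map mdegE.
by apply: eq_bigr => i _ /=; rewrite size_nseq.
Qed.

(* The library's [mmap] requires a nontrivial target ring, while [VG v W] is
   the zero ring when the cone is empty. *)
Section Evaluation.
Variables (n : nat) (B : comPzRingType) (b : 'I_n -> B).
Implicit Types (p q : {mpoly int[n]}) (m : 'X_{1..n}).

Definition moneval m : B := \prod_i b i ^+ m i.

Definition mpeval p : B := \sum_(m <- msupp p) moneval m *~ p@_m.

Lemma monevalD m1 m2 : moneval (m1 + m2)%MM = moneval m1 * moneval m2.
Proof. by rewrite -big_split; apply: eq_bigr => i _; rewrite mnmDE exprD. Qed.

Lemma moneval0 : moneval 0%MM = 1.
Proof. by rewrite /moneval big1 // => i _; rewrite mnm0E. Qed.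

Lemma monevalU i : moneval U_(i)%MM = b i.
Proof.
rewrite /moneval (bigD1 i) //= mnm1E eqxx big1 ?mulr1 // => j ji.
by rewrite mnm1E eq_sym (negPf ji).
Qed.

Lemma mpevalwE k p : (msize p <= k)%N ->
  mpeval p = \sum_(m : 'X_{1..n < k}) moneval m *~ p@_m.
Proof.
move=> lt_pk; rewrite /mpeval (ssrcomplements.big_mksub 'X_{1..n < k}) ?msupp_uniq //=; first last.
  by move=> m /msize_mdeg_lt /leq_trans; apply.
rewrite big_mkcond; apply: eq_bigr => m _; case: ifPn => // /memN_msupp_eq0->.
by rewrite mulr0z.
Qed.

Lemma mpeval_additive : zmod_morphism mpeval.
Proof.
move=> p q; pose k := maxn (msize (p - q)) (maxn (msize p) (msize q)).
have kP : [/\ msize (p - q) <= k, msize p <= k & msize q <= k]%N.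
  by rewrite /k !leq_max !leqnn !orbT.
case: kP => k1 k2 k3; rewrite (mpevalwE k1) (mpevalwE k2) (mpevalwE k3) -sumrB.
by apply: eq_bigr => m _; rewrite mcoeffB mulrzBr.
Qed.

HB.instance Definition _ :=
  GRing.isZmodMorphism.Build {mpoly int[n]} B mpeval mpeval_additive.

Lemma mpevalXm m : mpeval 'X_[m] = moneval m.
Proof. by rewrite /mpeval msuppX big_seq1 mcoeffX eqxx mulr1z. Qed.

Lemma mpolyZ_mulrz (c : int) p : c *: p = p *~ c.
Proof. by rewrite -[c in LHS]intz scaler_int. Qed.

Lemma mpeval_multiplicative : monoid_morphism mpeval.
Proof.
split; first by rewrite -mpolyX0 mpevalXm moneval0.
move=> p q; rewrite {1}[p]mpolyE {1}[q]mpolyE mulr_suml raddf_sum /=.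
rewrite [mpeval p]/mpeval mulr_suml; apply: eq_bigr => m _.
rewrite mulr_sumr raddf_sum /= [mpeval q]/mpeval mulr_sumr; apply: eq_bigr => m' _.
rewrite !mpolyZ_mulrz mulrzAl mulrzAr !raddfMz /= -mpolyXD mpevalXm monevalD.
by rewrite mulrzAl mulrzAr.
Qed.

HB.instance Definition _ :=
  GRing.isMonoidMorphism.Build {mpoly int[n]} B mpeval mpeval_multiplicative.

Lemma mpevalX i : mpeval 'X_i = b i.
Proof. by rewrite mpevalXm monevalU. Qed.

Lemma mpeval_emon (J : {set 'I_n}) : mpeval (emon J) = \prod_(i in J) b i.
Proof. by rewrite rmorph_prod /=; apply: eq_bigr => i _; rewrite mpevalX. Qed.

Lemma moneval_seq m : moneval m = \prod_(i <- mon_seq m) b i.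
Proof.
rewrite big_flatten big_map; apply: eq_bigr => i _.
by rewrite big_nseq iter_mulr_1.
Qed.

Lemma moneval_filt m d : (mdeg m <= d)%N -> moneval m \in filt b d.
Proof.
move=> lt_m; apply: Zspan_gen; exists (mon_seq m); rewrite ?moneval_seq //.
by rewrite size_mon_seq.
Qed.

Lemma mpeval_filt p d : (msize p <= d.+1)%N -> mpeval p \in filt b d.
Proof.
move=> lt_p; rewrite /mpeval big_seq rpred_sum // => m /msize_mdeg_lt lt_m.
by apply: rpredMz; rewrite moneval_filt // -ltnS (leq_trans lt_m).
Qed.

End Evaluation.

(** * Arithmetic of the associated graded ring *)

Section GradedTheory.
Variables (A : comPzRingType) (n : nat) (x : 'I_n -> A).
Local Notation gr_in := (gr_in x).
Local Notation filt := (filt x).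

Lemma gr_inE d a e : gr_in d a e = if e == d then gr_class x e a else 0.
Proof. by []. Qed.

Lemma gr_inD d a b : a \in filt d -> b \in filt d ->
  gr_in d (a + b) = gr_in d a + gr_in d b.
Proof.
move=> Fa Fb; apply: gradedP => e; rewrite -[RHS]/(gr_in d a e + gr_in d b e) !gr_inE.
by case: eqP => [->|_]; rewrite ?addr0 // gr_classD.
Qed.

Lemma gr_in0 d : gr_in d 0 = 0.
Proof.
apply: gradedP => e; rewrite gr_inE -[RHS]/(0 : gr x e).
by case: eqP => // _; rewrite gr_class0.
Qed.

Lemma gr_in_sum d I (r : seq I) (P : pred I) (F : I -> A) :
  (forall i, P i -> F i \in filt d) ->
  gr_in d (\sum_(i <- r | P i) F i) = \sum_(i <- r | P i) gr_in d (F i).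
Proof.
move=> FF; suff [] : gr_in d (\sum_(i <- r | P i) F i) = \sum_(i <- r | P i) gr_in d (F i)
    /\ \sum_(i <- r | P i) F i \in filt d by [].
elim/big_rec2: _ => [|i y z Pi [<- Fz]]; first by rewrite gr_in0 rpred0.
by rewrite gr_inD ?rpredD ?FF.
Qed.

Lemma gr_inN d a : a \in filt d -> gr_in d (- a) = - gr_in d a.
Proof.
move=> Fa; apply/eqP; rewrite -addr_eq0 -gr_inD ?rpredN // addNr gr_in0 //.
Qed.

Lemma gr_inMz d a c : a \in filt d -> gr_in d (a *~ c) = gr_in d a *~ c.
Proof.
move=> Fa; case: c => c.
  by rewrite -!pmulrn; elim: c => [|c IH]; rewrite ?gr_in0 // !mulrS gr_inD ?IH // rpredMn.
rewrite !NegzE !mulrNz gr_inN ?rpredMz // -!pmulrn; congr (- _).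
by elim: c => [|c IH] //; rewrite mulrS gr_inD ?IH -?mulrS // rpredMn.
Qed.

Lemma gr_in_eq0 d a : a \in filt d -> (gr_in d a = 0) <-> (a \in filt_prev x d).
Proof.
move=> Fa; split=> [/(congr1 (fun g : graded x => g d))|Fa'].
  rewrite gr_inE eqxx -[X in _ = X]/(0 : gr x d) -(gr_class0 x d).
  by move/gr_classE; rewrite subr0; apply=> //; rewrite rpred0.
apply: gradedP => e; rewrite gr_inE -[RHS]/(0 : gr x e) -(gr_class0 x e).
case: eqP => [->|_]; last by rewrite gr_class0.
by apply/gr_classE; rewrite ?subr0 ?rpred0.
Qed.

(** Both factors live in a single degree, so one summand of the convolution survives, and only in
    degree [i + j]. *)
Lemma gr_inM i j a b : a \in filt i -> b \in filt j ->
  gr_in i a * gr_in j b = gr_in (i + j) (a * b).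
Proof.
move=> Fa Fb; apply: gradedP => e.
rewrite -[LHS]/(\sum_(k < e.+1) gr_mul e (gr_in i a k) (gr_in j b (e - k)%N)) gr_inE.
have mul0 k k' (u : gr x k) : (k + k')%N = e ->
   gr_mul e u (0 : gr x k') = 0 /\ gr_mul e (0 : gr x k') u = 0.
  move=> kk; rewrite -(gr_class0 x k') -(gr_reprK u); split.
    by rewrite gr_mul_class ?mulr0 ?gr_class0 ?rpred0 ?gr_repr_filt.
  by rewrite gr_mul_class ?mul0r ?gr_class0 ?rpred0 ?gr_repr_filt // addnC.
have kK (k : 'I_e.+1) : (k + (e - k))%N = e by rewrite subnKC // -ltnS.
have [eij|neij] := eqVneq e (i + j)%N.
  have lt_ie : (i < e.+1)%N by rewrite eij ltnS leq_addr.
  rewrite (bigD1 (Ordinal lt_ie)) //= big1 ?addr0 => [|k /eqP ki].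
    have -> : (e - i)%N = j by rewrite eij addKn.
    by rewrite !eqxx gr_mul_class.
  rewrite (_ : (k == i :> nat) = false); last first.
    by apply/negbTE/eqP => h; apply: ki; exact: val_inj.
  by apply: (mul0 (e - k)%N k _ _).2; rewrite addnC kK.
rewrite big1 // => k _; rewrite !gr_inE.
case: (eqVneq (k : nat) i) => [ki|_]; last first.
  by apply: (mul0 (e - k)%N k _ _).2; rewrite addnC kK.
case: eqVneq => [kj|_]; first by case/negP: neij; rewrite -ki -kj kK.
exact: (mul0 _ _ _ _).1.
Qed.

Lemma gr_in_prod (s : seq 'I_n) :
  \prod_(i <- s) gr_in 1 (x i) = gr_in (size s) (\prod_(i <- s) x i).
Proof.
elim: s => [|i s IH]; first by rewrite !big_nil.
rewrite !big_cons IH gr_inM ?filt_gen //.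
by apply: Zspan_gen; exists s.
Qed.

(** Every monomial contributes a product of exactly [d] degree-one classes. This transports
    relations from [A] to its graded ring. *)
Lemma mpeval_gr_homog (p : {mpoly int[n]}) d : p \is d.-homog ->
  mpeval (fun i => gr_in 1 (x i)) p = gr_in d (mpeval x p).
Proof.
move=> /dhomogP hp; rewrite /mpeval big_seq [in RHS]big_seq gr_in_sum => [|m /hp mE].
  apply: eq_bigr => m /hp mE; rewrite gr_inMz ?moneval_filt ?mE //.
  by rewrite !moneval_seq gr_in_prod size_mon_seq mE.
by rewrite rpredMz // moneval_filt ?mE.
Qed.

Definition gr_component e (g : graded x) : gr x e := g e.

Lemma gr_component_zmod_morphism e : zmod_morphism (gr_component e).
Proof. by []. Qed.

HB.instance Definition _ e := GRing.isZmodMorphism.Build (graded x) (gr x e)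
  (gr_component e) (gr_component_zmod_morphism e).

Lemma component_sum I (r : seq I) (P : pred I) (F : I -> graded x) e :
  (\sum_(i <- r | P i) F i : graded x) e = \sum_(i <- r | P i) F i e.
Proof. exact: (raddf_sum (gr_component e)). Qed.

Lemma component_mulrz (g : graded x) c e : (g *~ c : graded x) e = g e *~ c.
Proof. exact: (raddfMz (gr_component e)). Qed.

(* A product of fewer than d generators vanishes in degree d. *)
Lemma gr_in_surj d a : a \in filt d ->
  exists p, mpeval (fun i => gr_in 1 (x i)) p = gr_in d a.
Proof.
move=> /asboolP[s [+ ->]]; elim: s => [_|[c y] s IH gen].
  by exists 0; rewrite raddf0 big_nil gr_in0.
have genF q : q \in (c, y) :: s -> q.2 \in filt d by move=> /gen; exact: Zspan_gen.
have [|p hp] := IH; first by move=> q qs; apply: gen; rewrite inE qs orbT.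
have sumF : \sum_(q <- s) q.2 *~ q.1 \in filt d.
  by rewrite big_seq rpred_sum // => q qs; rewrite rpredMz // genF // inE qs orbT.
have yF : y \in filt d by apply: (genF (c, y)); rewrite mem_head.
rewrite big_cons gr_inD ?rpredMz // -hp gr_inMz //=.
have [t st yE] : exists2 t : seq 'I_n, (size t <= d)%N & y = \prod_(i <- t) x i.
  by apply: (gen (c, y)); rewrite mem_head.
move: st; rewrite leq_eqVlt => /predU1P[sd|lt_sd].
  exists ((\prod_(i <- t) 'X_i) *~ c + p); rewrite rmorphD rmorphMz rmorph_prod /=.
  by under eq_bigr do rewrite mpevalX; rewrite gr_in_prod -yE sd.
exists p; suff -> : gr_in d y = 0 by rewrite mul0rz add0r.
apply/gr_in_eq0 => //; case: d lt_sd {yF genF sumF hp IH gen} => // d lt_sd.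
by apply: Zspan_gen; exists t.
Qed.

Lemma mpeval_gr_surj (g : graded x) :
  exists p, mpeval (fun i => gr_in 1 (x i)) p = g.
Proof.
have [N HN] := componentP g.
have [p hp] := choice (fun d => gr_in_surj (gr_repr_filt (g d))).
exists (\sum_(d < N) p d); rewrite raddf_sum /=; under eq_bigr do rewrite hp.
apply: gradedP => e; rewrite component_sum; have [Ne|eN] := leqP N e.
  rewrite HN // big1 // => i _; rewrite gr_inE gtn_eqF //.
  exact: leq_trans (ltn_ord i) Ne.
rewrite (bigD1 (Ordinal eN)) //= eqxx gr_reprK big1 ?addr0 // => i /eqP ie.
by case: eqP => // ei; case: ie; apply: val_inj.
Qed.

End GradedTheory.

(** * Initial forms of the relations *)

Section TopForms.
Variable n : nat.
Implicit Types (p q a b h g : {mpoly int[n]}) (J : {set 'I_n}).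

Lemma msizeM_leD p q d e : (msize p <= d.+1)%N -> (msize q <= e)%N ->
  (msize (p * q) <= d + e)%N.
Proof.
move=> hp hq; have [->|p0] := eqVneq p 0; first by rewrite mul0r mmeasure0.
have [->|q0] := eqVneq q 0; first by rewrite mulr0 mmeasure0.
by rewrite msizeM // -subn1 leq_subLR add1n -addSn leq_add.
Qed.

Lemma msizeD_le p q d : (msize p <= d)%N -> (msize q <= d)%N ->
  (msize (p + q) <= d)%N.
Proof. by move=> hp hq; rewrite (leq_trans (mmeasureD_le _ _ _)) // geq_max hp. Qed.

Lemma msizeB_le p q d : (msize p <= d)%N -> (msize q <= d)%N ->
  (msize (p - q) <= d)%N.
Proof. by move=> hp hq; rewrite msizeD_le // mmeasureN. Qed.

Lemma dhomog_msize_le h d : h \is d.-homog -> (msize h <= d.+1)%N.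
Proof.
move=> /dhomogP hh; rewrite msizeE big_seq; elim/big_ind: _ => //.
  by move=> x y hx hy; rewrite geq_max hx.
by move=> m /hh ->.
Qed.

Lemma pihomog_small p d : (msize p <= d)%N -> pihomog mdeg d p = 0.
Proof.
move=> hp; rewrite pihomogE big_seq_cond big1 // => m /andP[/msize_mdeg_lt + /eqP md].
by rewrite md ltnNge hp.
Qed.

Lemma in_deg_homog p : in_deg p \is (msize p).-1.-homog.
Proof. exact: pihomogP. Qed.

Lemma msize_sub_in_deg p : (msize (p - in_deg p) <= (msize p).-1)%N.
Proof.
have [->|p0] := eqVneq p 0; first by rewrite /in_deg raddf0 subrr mmeasure0.
have -> : p - in_deg p = \sum_(d < (msize p).-1) pihomog mdeg d p.
  rewrite /in_deg {1}(@pihomog_partitionE _ _ mdeg _ p (leqnn _)).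
  have : (0 < msize p)%N by rewrite lt0n mmeasure_poly_eq0.
  by case: (msize p) => // k _; rewrite big_ord_recr /= addrK.
elim/big_ind: _ => [|x y hx hy|d _]; [by rewrite mmeasure0|exact: msizeD_le|].
exact: leq_trans (dhomog_msize_le (pihomogP _ _ _)) (ltn_ord d).
Qed.

(** As [msize] is the degree plus one, the bound puts [a - h] in degrees below [d]. Allowing [h] to
    be zero makes the notion multiplicative with no side condition; only [topform_in_deg] asks for
    [h != 0]. *)
Definition topform d h a := h \is d.-homog /\ (msize (a - h) <= d)%N.

Lemma topform_msize d h a : topform d h a -> (msize a <= d.+1)%N.
Proof.
move=> [hh ha]; rewrite -(subrK h a); apply: msizeD_le; first exact: leqW.
exact: dhomog_msize_le.
Qed.

Lemma topform_in_deg d h a : topform d h a -> h != 0 -> in_deg a = h.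
Proof.
move=> /[dup] /topform_msize sa [hh ha] h0.
have sa' : msize a = d.+1.
  apply/eqP; rewrite eqn_leq sa ltnNge; apply/negP => sad.
  case/negP: h0; rewrite -(pihomog_dE hh) -[h](subKr a).
  by rewrite raddfB /= !pihomog_small ?subrr.
by rewrite /in_deg sa' /= -[a in LHS](subrK h) raddfD /= pihomog_small // add0r pihomog_dE.
Qed.

Lemma topformM d e h k a b : topform d h a -> topform e k b ->
  topform (d + e) (h * k) (a * b).
Proof.
move=> [hh ha] [hk hb]; split; first exact: dhomogM.
have -> : a * b - h * k = b * (a - h) + h * (b - k) by ring.
apply: msizeD_le; last by apply: msizeM_leD => //; exact: dhomog_msize_le.
by rewrite addnC msizeM_leD // (@topform_msize e k).
Qed.

Lemma topform_homog d h : h \is d.-homog -> topform d h h.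
Proof. by split=> //; rewrite subrr mmeasure0. Qed.

Lemma homogX i : ('X_i : {mpoly int[n]}) \is 1.-homog.
Proof. by rewrite dhomogX; exact/eqP/mdeg1. Qed.

Lemma mvar_neq0 i : ('X_i : {mpoly int[n]}) != 0.
Proof. by rewrite -(mmeasure_poly_eq0 mdeg) msizeX. Qed.

Lemma topform_X1 i : topform 1 ('X_i : {mpoly int[n]}) ('X_i - 1).
Proof.
split; first exact: homogX.
by rewrite addrC addKr mmeasureN mmeasure1.
Qed.

Lemma topform_prod (s : seq 'I_n) (F : 'I_n -> {mpoly int[n]}) :
  (forall i, topform 1 'X_i (F i)) ->
  topform (size s) (\prod_(i <- s) 'X_i) (\prod_(i <- s) F i).
Proof.
move=> FX; elim: s => [|i s IH].
  by rewrite !big_nil; apply: topform_homog; exact: dhomog1.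
by rewrite !big_cons -[size _]/(1 + size s)%N; exact: topformM.
Qed.

Lemma topform_prodX1 J :
  topform #|J| (emon J) (\prod_(j in J) ('X_j - 1) : {mpoly int[n]}).
Proof.
by rewrite cardE /emon -!big_enum; apply: topform_prod; exact: topform_X1.
Qed.

Lemma emon_homog J : emon J \is #|J|.-homog.
Proof. by have [] := topform_prodX1 J. Qed.

Lemma emonD1 J i : i \in J -> emon J = 'X_i * emon (J :\ i).
Proof. exact: big_setD1. Qed.

Lemma emonU J J' : J :&: J' = finset.set0 -> emon (J :|: J') = emon J * emon J'.
Proof.
move=> disj; rewrite /emon (big_setID J) /= finset.setUK; congr (_ * _).
apply: eq_bigl => i; rewrite !inE; case: (boolP (i \in J)) => //= iJ.
by apply/esym/negP => iJ'; have := finset.in_set0 i; rewrite -disj inE iJ iJ'.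
Qed.

Lemma emonID J J' : J' \subset J -> emon J = emon (J :\: J') * emon J'.
Proof.
by move=> sub; rewrite /emon (big_setID J') /= mulrC (finset.setIidPr sub).
Qed.

Lemma emon_neq0 J : emon J != 0.
Proof.
apply/eqP => /(congr1 (mpeval (fun=> 1 : int))).
rewrite mpeval_emon raddf0 big1 // => /eqP; by rewrite oner_eq0.
Qed.

(** The opposite of the part of degree [#|J|.-1] of the product of the ['X_j - 1], needed because
    the top parts cancel in a circuit relation. *)
Definition subtop J : {mpoly int[n]} := \sum_(j in J) emon (J :\ j).

Lemma prodX1_subtop J :
  (msize (\prod_(j in J) ('X_j - 1) - emon J + subtop J) <= #|J|.-1)%N.
Proof.
have [k] := ubnP #|J|; elim: k J => // k IH J ltk.
have [->|[i iJ]] := set_0Vmem J.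
  by rewrite /subtop /emon !big_set0 subrr addr0 mmeasure0.
have cJ : #|J| = (#|J :\ i|).+1 by rewrite (cardsD1 i J) iJ.
have {IH} := IH (J :\ i); rewrite -ltnS -cJ => /(_ ltk).
have sE : subtop J = emon (J :\ i) + 'X_i * subtop (J :\ i).
  rewrite /subtop (big_setD1 i iJ) mulr_sumr; congr (_ + _).
  apply: eq_bigr => j; rewrite in_setD1 => /andP[ji jJ].
  rewrite (@emonD1 _ i) ?in_setD1 1?eq_sym ?ji //.
  by congr (_ * emon _); apply/setP => a; rewrite !inE andbCA.
rewrite (big_setD1 i iJ) /= (emonD1 iJ) sE cJ /=.
have [_] := topform_prodX1 (J :\ i).
set P := \prod_(_ in _) _; set e := emon _; set s := subtop _ => h1 h2.
have -> : ('X_i - 1) * P - 'X_i * e + (e + 'X_i * s) = 'X_i * (P - e + s) - (P - e) by ring.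
apply: msizeB_le => //.
(* The predecessor in the bound is truncated: for at most one index the remainder must vanish, and a
   nonzero remainder forces [#|J :\ i|] to be at least 2. *)
have [->|nz] := eqVneq (P - e + s) 0; first by rewrite mulr0 mmeasure0.
have : (0 < msize (P - e + s))%N by rewrite lt0n mmeasure_poly_eq0.
move=> pos; apply: leq_trans (@msizeM_leD 'X_i (P - e + s) 1 _ _ h2) _.
  by rewrite msizeX mdeg1.
have : (0 < #|J :\ i|.-1)%N by exact: leq_trans pos h2.
by case: #|J :\ i| => [|[|?]].
Qed.

Definition csign (C : {set 'I_n} * {set 'I_n}) j : int :=
  if j \in C.1 then 1 else -1.

(** Both products start with [emon (usupp C)]. What remains in the next degree is [emon C.2 * subtop
    C.1 - emon C.1 * subtop C.2], that is, the signed sum over the elements removed from the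
    circuit. *)
Lemma circuit_topform (C : {set 'I_n} * {set 'I_n}) :
    C.1 :&: C.2 = finset.set0 -> usupp C != finset.set0 ->
  topform #|usupp C|.-1 (\sum_(j in usupp C) emon (usupp C :\ j) *~ csign C j)
    (emon C.1 * \prod_(j in C.2) ('X_j - 1) - emon C.2 * \prod_(j in C.1) ('X_j - 1)).
Proof.
case: C => A B; rewrite /usupp /= => disj ne0.
have disj' i : i \in A -> i \in B = false.
  by move=> iA; apply/negP => iB; have := finset.in_set0 i; rewrite -disj inE iA iB.
have cAB : #|A :|: B| = (#|A| + #|B|)%N by rewrite cardsU disj cards0 subn0.
split.
  apply: rpred_sum => j jC; apply: rpredMz.
  by have := emon_homog ((A :|: B) :\ j); rewrite (cardsD1 j (_ :|: _)) jC.
have hE : \sum_(j in A :|: B) emon ((A :|: B) :\ j) *~ csign (A, B) j =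
    emon B * subtop A - emon A * subtop B.
  rewrite (big_setID A) /= finset.setUK.
  have -> : (A :|: B) :\: A = B.
    apply/setP => i; rewrite !inE; have [/disj'->//|//] := boolP (i \in A).
  congr (_ + _).
    rewrite mulr_sumr; apply: eq_bigr => j jA; rewrite /csign jA mulr1z mulrC.
    rewrite -emonU; last first.
      by apply/setP => i; rewrite !inE; have [/disj'->|] := boolP (i \in A); rewrite ?andbF.
    congr emon; apply/setP => i; rewrite !inE; case: eqP => //= ->.
    by rewrite disj'.
  rewrite mulr_sumr -sumrN; apply: eq_bigr => j jB.
  have jA : j \notin A by apply/negP => /disj'; rewrite jB.
  rewrite /csign (negPf jA) mulrN1z -emonU; last first.
    by apply/setP => i; rewrite !inE; have [/disj'->|] := boolP (i \in A); rewrite ?andbF.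
  congr (- emon _); apply/setP => i; rewrite !inE; case: eqP => //= ->.
  by rewrite (negPf jA).
rewrite hE; have := prodX1_subtop A; have := prodX1_subtop B.
have := emon_homog A; have := emon_homog B.
set PA := \prod_(_ in A) _; set PB := \prod_(_ in B) _.
set eA := emon A; set eB := emon B; set sA := subtop A; set sB := subtop B.
move=> /dhomog_msize_le heB /dhomog_msize_le heA hB hA.
have -> : eA * PB - eB * PA - (eB * sA - eA * sB) =
  eA * (PB - eB + sB) - eB * (PA - eA + sA) by ring.
have low (e r : {mpoly int[n]}) c c' : (msize e <= c.+1)%N -> (msize r <= c'.-1)%N ->
    (msize (e * r) <= (c + c').-1)%N.
  move=> he hr; have [->|nz] := eqVneq r 0; first by rewrite mulr0 mmeasure0.
  have : (0 < msize r)%N by rewrite lt0n mmeasure_poly_eq0.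
  move=> pos; apply: leq_trans (msizeM_leD he hr) _.
  have : (0 < c'.-1)%N by exact: leq_trans pos hr.
  by move: (c') => [|[|?]]; lia.
rewrite cAB; apply: msizeB_le; first exact: low.
by rewrite addnC; exact: low.
Qed.

Lemma circuit_top_neq0 (C : {set 'I_n} * {set 'I_n}) : usupp C != finset.set0 ->
  \sum_(j in usupp C) emon (usupp C :\ j) *~ csign C j != 0.
Proof.
(* At the point with coordinate [i] zero and the others one, only the summand for [j = i]
   survives. *)
case/set0Pn => i iC; apply/eqP => /(congr1 (mpeval (fun j => (j != i)%:R : int))).
rewrite raddf_sum raddf0 /= (bigD1 i) //= big1 => [|j /andP[jC ji]].
  rewrite addr0 raddfMz /= mpeval_emon big1 => [|j]; last first.
    by rewrite in_setD1 => /andP[->].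
  by rewrite /csign; case: ifP.
rewrite raddfMz /= mpeval_emon (bigD1 i) /=; last by rewrite in_setD1 eq_sym ji.
by rewrite eqxx mul0r mul0rz.
Qed.

Lemma cone_topform J J' : J :&: J' = finset.set0 ->
  in_deg (emon J * \prod_(j in J') ('X_j - 1)) = emon (J :|: J').
Proof.
move=> disj; rewrite emonU //; apply: topform_in_deg; last by rewrite mulf_neq0 ?emon_neq0.
exact: topformM (topform_homog (emon_homog J)) (topform_prodX1 J').
Qed.

End TopForms.

(** * The NBC monomials span both quotients *)

Section Spanning.
Variables (R : realType) (l n : nat) (v : 'I_n -> 'rV[R]_l) (W : {set 'I_n}).
Implicit Types (p q g : {mpoly int[n]}) (S J : {set 'I_n}).

Local Notation G := (relations v W).
Local Notation inG := (@in_deg n @` relations v W).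

Lemma ideal_gen_gen (A : comPzRingType) (K : set A) (g : A) : K g -> g \in ideal_gen K.
Proof.
move=> Kg; apply/asboolP; exists [:: (1, g)]; split=> [q|].
  by rewrite inE => /eqP->.
by rewrite big_seq1 mul1r.
Qed.

(** Spanning of the quotient is expressed on polynomials rather than on classes, so that degrees and
    homogeneous parts stay available. *)
Definition nbc_span (K : set {mpoly int[n]}) : {mpoly int[n]} -> bool :=
  Zspan [set p | (exists2 N, N \in NBC v W & p = emon N) \/ p \in ideal_gen K].

HB.instance Definition _ K := GRing.ZmodClosed.on (nbc_span K).

Lemma nbc_span_ideal K p : p \in ideal_gen K -> p \in nbc_span K.
Proof. by move=> Kp; apply: Zspan_gen; right. Qed.

Lemma nbc_span_emon K N : N \in NBC v W -> emon N \in nbc_span K.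
Proof. by move=> NN; apply: Zspan_gen; left; exists N. Qed.

Lemma nbc_spanP K p : p \in nbc_span K ->
  exists c, p - \sum_(N in NBC v W) emon N *~ c N \in ideal_gen K.
Proof.
move=> /asboolP[s [+ ->]]; elim: s => [_|[a q] s IH gen].
  by exists (fun=> 0); rewrite big_nil big1 ?subr0 ?rpred0.
have [|c hc] := IH; first by move=> r rs; apply: gen; rewrite inE rs orbT.
rewrite big_cons /=; have [|[N NN qE]|Kq] := gen (a, q).
- by rewrite mem_head.
- exists (fun N' => c N' + (N' == N)%:Z * a).
  have -> : \sum_(N' in NBC v W) emon N' *~ (c N' + (N' == N)%:Z * a) =
      \sum_(N' in NBC v W) emon N' *~ c N' + emon N *~ a.
    have -> : emon N *~ a = \sum_(N' in NBC v W) emon N' *~ ((N' == N)%:Z * a).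
      rewrite (bigD1 N) //= eqxx mul1r big1 ?addr0 // => N' /andP[_ /negPf->].
      by rewrite mul0r mulr0z.
    by rewrite -big_split; apply: eq_bigr => N' _; rewrite mulrzDr.
  by move: qE => /= ->; rewrite (addrC (_ *~ a)) opprD addrACA subrr addr0.
exists c; rewrite -addrA rpredD // rpredMz //.
Qed.

Lemma square_in i : 'X_i ^+ 2 \in ideal_gen inG.
Proof.
apply: ideal_gen_gen; exists ('X_i ^+ 2 - 'X_i); first exact: Idempotent.
apply: (@topform_in_deg _ 2); last by rewrite expf_neq0 // mvar_neq0.
split; first exact: (dhomogMn 2 (homogX i)).
by rewrite addrC addKr mmeasureN msizeX mdeg1.
Qed.

Lemma unit_in i : i \in W -> 'X_i \in ideal_gen inG.
Proof.
move=> iW; apply: ideal_gen_gen; exists ('X_i - 1); first exact: Unit.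
by apply: topform_in_deg (topform_X1 i) _; exact: mvar_neq0.
Qed.

Lemma circuit_disjoint C : signed_circuit v C -> C.1 :&: C.2 = finset.set0.
Proof.
move=> /circuit_dependency[lam _ ->]; apply/setP => i; rewrite !inE /=.
by case: ltgtP.
Qed.

(** The circuit meets [W] on one side only, so deleting [W] from that side leaves the product over
    all of the circuit outside [W]. *)
Lemma cone_circuit_in C : signed_circuit v C ->
  (W :&: C.1 != finset.set0 /\ W :&: C.1 = W :&: usupp C) \/
  (W :&: C.2 != finset.set0 /\ W :&: C.2 = W :&: usupp C) ->
  emon (usupp C :\: W) \in ideal_gen inG.
Proof.
move=> Cc h; apply: ideal_gen_gen; have disj := circuit_disjoint Cc.
have disj' i : i \in C.1 -> i \in C.2 = false.
  by move=> i1; apply/negP => i2; have := finset.in_set0 i; rewrite -disj inE i1 i2.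
case: h => -[ne0 /setP hW]; [exists (emon (C.1 :\: W) * \prod_(j in C.2) ('X_j - 1))
    |exists (emon (C.2 :\: W) * \prod_(j in C.1) ('X_j - 1))].
- by apply: ConeCircuitPos => //; exact/setP.
- rewrite cone_topform; last first.
    by apply/setP => i; rewrite !inE; have [/disj'->|] := boolP (i \in C.1); rewrite ?andbF.
  congr emon; apply/setP => i; have := hW i; rewrite !inE.
  by case: (boolP (i \in C.1)) => [/disj'->|_]; case: (i \in W); case: (i \in C.2).
- by apply: ConeCircuitNeg => //; exact/setP.
rewrite cone_topform; last first.
  by apply/setP => i; rewrite !inE; have [/disj'->|] := boolP (i \in C.1); rewrite ?andbF.
congr emon; apply/setP => i; have := hW i; rewrite !inE.
by case: (boolP (i \in C.1)) => [/disj'->|_]; case: (i \in W); case: (i \in C.2).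
Qed.

Lemma circuit_in C : signed_circuit v C -> W :&: usupp C = finset.set0 ->
  \sum_(j in usupp C) emon (usupp C :\ j) *~ csign C j \in ideal_gen inG.
Proof.
move=> Cc CW; apply: ideal_gen_gen.
exists (emon C.1 * \prod_(j in C.2) ('X_j - 1) - emon C.2 * \prod_(j in C.1) ('X_j - 1)).
  exact: Circuit.
have ne0 : usupp C != finset.set0 by case: Cc.
exact: topform_in_deg (circuit_topform (circuit_disjoint Cc) ne0) (circuit_top_neq0 ne0).
Qed.

Lemma ideal_emon J S : J \subset S -> emon J \in ideal_gen inG ->
  emon S \in nbc_span inG.
Proof.
by move=> JS IJ; rewrite (emonID JS) nbc_span_ideal // ideal_gen_mull.
Qed.

(* Rewriting with the broken circuit of C replaces some j in S by the smaller
   index min C, so the sum of the indices decreases. *)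
Lemma emon_nbc_span S : emon S \in nbc_span inG.
Proof.
pose wt (J : {set 'I_n}) := (\sum_(i in J) (i : nat))%N.
have [k] := ubnP (wt S); elim: k S => // k IH S ltk.
have [/nbc_span_emon//|nS] := boolP (S \in NBC v W).
have [SW|[i]] := set_0Vmem (S :&: W); last first.
  rewrite inE => /andP[iS iW]; apply: (@ideal_emon [set i]%SET).
    by rewrite finset.sub1set.
  by rewrite /emon big_set1 unit_in.
have [C Cc [[ne0 CW CS]|[ne0 CW CS]|[CW [i [iC imin CS]]]]] := not_NBC SW nS.
- by apply: ideal_emon CS _; apply: cone_circuit_in => //; left.
- by apply: ideal_emon CS _; apply: cone_circuit_in => //; right.
set T := S :\: (usupp C :\ i).
have ST : emon S = emon T * emon (usupp C :\ i) by exact: emonID.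
have Tnot j : j \in usupp C -> j \in T -> j = i.
  by move=> jC; rewrite finset.in_setD in_setD1 jC andbT => /andP[/negPn/eqP].
(* Multiplied by [emon T], the circuit form has [emon S] as its summand for [i], up to sign; the
   other summands have [i] in place of some larger [j]. *)
have := ideal_gen_mull (emon T) (circuit_in Cc CW).
move/nbc_span_ideal; rewrite (bigD1 i) //= mulrDr mulrzAr -ST mulr_sumr.
rewrite rpredDr; last first.
  apply: rpred_sum => j /andP[jC ji]; rewrite mulrzAr rpredMz //.
  (* If [i] already divides [emon T], the summand contains the square of ['X_i]. *)
  have [iT|iT] := boolP (i \in T).
    apply: nbc_span_ideal; rewrite (emonD1 iT) (@emonD1 _ (usupp C :\ j) i); last first.
      by rewrite in_setD1 eq_sym ji.
    rewrite mulrACA -expr2 mulrC ideal_gen_mull //; exact: square_in.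
  have disj : T :&: (usupp C :\ j) = finset.set0.
    apply/setP => a; rewrite finset.in_setI in_setD1 finset.in_set0; apply/negP => /and3P[aT _ aC].
    by move: iT; rewrite -(Tnot a aC aT) aT.
  rewrite -emonU //; apply: IH.
  have wtU (J J' : {set 'I_n}) : J :&: J' = finset.set0 -> wt (J :|: J') = (wt J + wt J')%N.
    move=> dJ; rewrite /wt (big_setID J) /= finset.setUK; congr (_ + _)%N.
    apply: eq_bigl => a; rewrite !inE; case: (boolP (a \in J)) => //= aJ.
    by apply/esym/negP => aJ'; have := finset.in_set0 a; rewrite -dJ inE aJ aJ'.
  have wS : wt S = (wt T + wt (usupp C :\ i))%N.
    by rewrite /wt (big_setID (usupp C :\ i)) /= addnC (finset.setIidPr CS).
  have wi : wt (usupp C) = (i + wt (usupp C :\ i))%N by exact: big_setD1.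
  have wj : wt (usupp C) = (j + wt (usupp C :\ j))%N by exact: big_setD1.
  have lt_ij : (i < j)%N.
    by rewrite ltn_neqAle imin // andbT; apply: contraNneq ji => h; apply/eqP/val_inj.
  rewrite wtU //; apply: leq_trans (_ : wt T + wt (usupp C :\ i) <= k)%N.
    by rewrite ltn_add2l -(ltn_add2l j) -wj wi ltn_add2r.
  by rewrite -wS.
(* The coefficient of [emon S] is 1 or -1, so no division is required over the integers. *)
by rewrite /csign; case: ifP => _; rewrite ?mulr1z // mulrN1z rpredN.
Qed.

Lemma nbc_span_in_deg p : p \in nbc_span inG.
Proof.
rewrite [p]mpolyE; apply: rpred_sum => m _; rewrite mpolyZ_mulrz rpredMz //.
have [/existsP[i mi]|] := boolP [exists i, 1 < m i]%N.
  have -> : 'X_[m] = 'X_[m - U_(i) *+ 2]%MM * 'X_i ^+ 2 :> {mpoly int[n]}.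
    rewrite mpolyXn -mpolyXD submK //; apply/mnm_lepP => j.
    by rewrite mulmnE mnm1E; case: eqP => // <-; rewrite mul1n.
  by rewrite nbc_span_ideal // ideal_gen_mull // square_in.
rewrite negb_exists => /forallP sqf.
suff -> : 'X_[m] = emon [set i | m i != 0%N]%SET by exact: emon_nbc_span.
rewrite mpolyXE_id /emon [RHS]big_mkcond; apply: eq_bigr => i _; rewrite inE.
by have := sqf i; case: (m i) => [|[|?]] //=.
Qed.

(** Reduce the initial form of [p] modulo the initial forms, then trade each initial form for its
    relation; all errors have smaller degree. *)
Lemma nbc_span_relations p : p \in nbc_span G.
Proof.
have [k] := ubnP (msize p); elim: k p => // k IH p ltk.
have [p0|p0] := eqVneq p 0; first by rewrite p0 rpred0.
have sp : (0 < msize p)%N by rewrite lt0n mmeasure_poly_eq0.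
pose d := (msize p).-1.
have IHd q : (msize q <= d)%N -> q \in nbc_span G.
  by move=> hq; apply: IH; rewrite /d in hq; apply: leq_ltn_trans hq _; rewrite prednK.
rewrite -(subrK (in_deg p) p); apply: rpredD.
  by apply: IHd; exact: msize_sub_in_deg.
have [c] := nbc_spanP (nbc_span_in_deg (in_deg p)).
(* An expression of [q] through initial forms may involve every degree; projecting to degree [d]
   keeps only multiples whose degree is known. *)
set q := _ - _ => Iq; have {}Iq : pihomog mdeg d q \in nbc_span G.
  case/asboolP: Iq => s [Gs ->]; rewrite raddf_sum big_seq rpred_sum // => -[a g'] /Gs /= [g Gg <-].
  rewrite [a]mpolyE mulr_suml raddf_sum rpred_sum // => m _.
  rewrite mpolyZ_mulrz mulrzAl raddfMz rpredMz //=.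
  have hom : ('X_[m] * in_deg g : {mpoly int[n]}) \is (mdeg m + (msize g).-1).-homog.
    by apply: dhomogM (in_deg_homog g); rewrite dhomogX.
  have [md|md] := eqVneq (mdeg m + (msize g).-1)%N d; last by rewrite (pihomog_ne0 md hom) rpred0.
  (* Replacing [in_deg g] by [g] costs a polynomial of degree below [d], which the induction
     covers. *)
  rewrite pihomog_dE -?md // -[in_deg g](subKr g) mulrBr rpredB //.
    by rewrite nbc_span_ideal // ideal_gen_mull // ideal_gen_gen.
  by apply: IHd; rewrite -md msizeM_leD ?msize_sub_in_deg // msizeX.
have -> : in_deg p = pihomog mdeg d q + \sum_(N in NBC v W) pihomog mdeg d (emon N) *~ c N.
  rewrite /q raddfB /= (pihomog_dE (in_deg_homog p)) [X in _ - X](raddf_sum (pihomog mdeg d)).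
  by under [X in _ - X]eq_bigr do rewrite raddfMz; rewrite subrK.
rewrite rpredD // rpred_sum // => N NN; rewrite rpredMz //.
have [Nd|Nd] := eqVneq #|N| d; last by rewrite (pihomog_ne0 Nd (emon_homog N)) rpred0.
by rewrite pihomog_dE -?Nd ?emon_homog // nbc_span_emon.
Qed.

End Spanning.

Section RmorphEval.
Variables (n : nat) (A B : comPzRingType) (phi : {rmorphism A -> B}).

Lemma rmorph_mpeval (b : 'I_n -> A) p :
  phi (mpeval b p) = mpeval (fun i => phi (b i)) p.
Proof.
rewrite rmorph_sum; apply: eq_bigr => m _; rewrite rmorphMz rmorph_prod.
by congr (_ *~ _); apply: eq_bigr => i _; rewrite rmorphXn.
Qed.

End RmorphEval.

(** * Chambers as sign vectors, and vanishing of the relations *)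

Section Chambers.
Variables (R : realType) (l n : nat) (v : 'I_n -> 'rV[R]_l) (W : {set 'I_n}).
Implicit Types (y z : 'rV[R]_l) (i : 'I_n).

Local Notation x := (heaviside v W).
Local Notation chamber := (set_type (chambers v W)).

Definition VGeval (C : chamber) (f : VG v W) : int := f C.

Lemma VGeval_zmod_morphism C : zmod_morphism (VGeval C). Proof. by []. Qed.
Lemma VGeval_monoid_morphism C : monoid_morphism (VGeval C). Proof. by []. Qed.

HB.instance Definition _ C :=
  GRing.isZmodMorphism.Build (VG v W) int (VGeval C) (VGeval_zmod_morphism C).
HB.instance Definition _ C :=
  GRing.isMonoidMorphism.Build (VG v W) int (VGeval C) (VGeval_monoid_morphism C).

Lemma dot_continuous (u : 'rV[R]_l) : continuous (dot u).
Proof.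
rewrite /dot; elim: (index_enum _) => [|j s IH] y.
  under eq_fun do rewrite big_nil.
  exact: cst_continuous.
under eq_fun do rewrite big_cons.
have h : {for y, continuous (fun w : 'rV[R]_l => u 0 j * w 0 j)}.
  exact: (continuousM (@cst_continuous _ _ (u 0 j) y) (@coord_continuous _ _ _ 0 j y)).
exact: (continuousD h (IH y)).
Qed.

(** The image of a component under a linear form is an interval; a sign change would put a point of
    the hyperplane in the complement. *)
Lemma component_sign y z i : connected_component (complement v) y z ->
  complement v y -> 0 < dot (v i) y -> 0 < dot (v i) z.
Proof.
move=> yz cy yi; rewrite ltNge; apply/negP => zi.
have conn : connected (dot (v i) @` connected_component (complement v) y).
  apply: connected_continuous_connected; first exact: component_connected.
  by apply: continuous_subspaceT; exact: dot_continuous.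
have [w yw w0] : (dot (v i) @` connected_component (complement v) y) 0.
  apply: (proj1 (connected_intervalP _) conn (dot (v i) z) (dot (v i) y)).
  - by exists z.
  - by exists y => //; exact: connected_component_refl.
  - by rewrite zi ltW.
by have /(_ i) := connected_component_sub yw; rewrite mem_hyperplane w0 eqxx.
Qed.

Lemma complement_dot y i : complement v y -> dot (v i) y != 0.
Proof. by move=> /(_ i); rewrite mem_hyperplane. Qed.

Lemma component_halfspace y i : complement v y ->
  (connected_component (complement v) y `<=` halfspace v i) <-> 0 < dot (v i) y.
Proof.
move=> cy; split=> [|yi z yz]; first by apply; exact: connected_component_refl.
exact: component_sign yz cy yi.
Qed.

Lemma chamber_point (C : chamber) : exists y,
  [/\ complement v y, cone v W y, val C = connected_component (complement v) y &
      forall i, x i C = (0 < dot (v i) y)%R%:R].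
Proof.
have [[y cy CE] CW] := set_valP C; exists y; split=> //.
  by apply: CW; rewrite CE; exact: connected_component_refl.
move=> i; rewrite /heaviside CE; case: asboolP => [/component_halfspace->//|h].
by case: (boolP (0 < _)) => // /(proj2 (component_halfspace i cy)).
Qed.

Lemma point_chamber y : complement v y -> cone v W y ->
  exists C : chamber, forall i, x i C = (0 < dot (v i) y)%R%:R.
Proof.
move=> cy Wy; have CP : chambers v W (connected_component (complement v) y).
  split; first by exists y.
  by move=> z yz i iW; exact: ((component_halfspace i cy).2 (Wy i iW)).
exists (SigSub (mem_set CP)) => i; rewrite /heaviside /=.
case: asboolP => [/component_halfspace->//|h].
by case: (boolP (0 < _)) => // /(proj2 (component_halfspace i cy)).
Qed.

(** On the segment from [y] to [z] each form is a convex combination of two nonzero values of the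
    same sign, so the segment stays in the complement. *)
Lemma same_signs_component y z : complement v y -> complement v z ->
  (forall i, (0 < dot (v i) y) = (0 < dot (v i) z)) ->
  connected_component (complement v) y = connected_component (complement v) z.
Proof.
move=> cy cz same; apply: same_connected_component.
pose g (t : R) : 'rV[R]_l := y + t *: (z - y).
have gE i t : dot (v i) (g t) = (1 - t) * dot (v i) y + t * dot (v i) z.
  by rewrite /g dotDr dotZr dotDr -scaleN1r dotZr; ring.
apply: (@connected_component_max _ _ (g @` `[0, 1])).
- by exists 0; rewrite /= ?in_itv /= ?lexx ?ler01 // /g scale0r addr0.
- move=> _ [t + <-] i; rewrite /= in_itv /= => /andP[t0 t1].
  rewrite mem_hyperplane gE; have := same i.
  move: (complement_dot i cy) (complement_dot i cz); rewrite !neq_lt.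
  case/orP=> yi /orP[] zi; rewrite ?yi ?zi ?(lt_gtF yi) ?(lt_gtF zi) // => _.
    by apply/orP; left; nra.
  by apply/orP; right; nra.
- apply: connected_continuous_connected; first exact: segment_connected.
  apply: continuous_subspaceT => t.
  exact: (continuousD (@cst_continuous _ _ y t) (@scalel_continuous _ _ (z - y) t)).
- by exists 1; rewrite /= ?in_itv /= ?lexx ?ler01 // /g scale1r addrC subrK.
Qed.

Lemma chamber_inj (C C' : chamber) : (forall i, x i C = x i C') -> C = C'.
Proof.
have [[y [cy _ CE yx]] [z [cz _ CE' zx]]] := (chamber_point C, chamber_point C').
move=> same; apply: val_inj; rewrite CE CE'; apply: same_signs_component => // i.
by have := same i; rewrite yx zx; do 2!case: (0 < _).
Qed.

Lemma mpeval_heaviside_surj (f : VG v W) : exists p, mpeval x p = f.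
Proof.
(* [ind T] evaluates to the indicator of the chamber positive exactly on [T], if there is one;
   otherwise it evaluates to 0 and its coefficient can be anything. *)
pose ind (T : {set 'I_n}) : {mpoly int[n]} := \prod_i (if i \in T then 'X_i else 1 - 'X_i).
have [c hc] : exists c : {set 'I_n} -> int,
    forall C, c [set i | x i C == 1]%SET = f C.
  suff h (T : {set 'I_n}) : exists a, forall C : chamber, T = [set i | x i C == 1]%SET -> a = f C.
    by have [c hc] := choice h; exists c => C; exact: hc.
  have [[C TC]|no] := pselect (exists C : chamber, T = [set i | x i C == 1]%SET).
    exists (f C) => C' TC'; congr f; apply: chamber_inj => i.
    have := TC; rewrite TC' => /setP/(_ i); rewrite !inE.
    by rewrite /heaviside; do 2!case: asboolP.
  by exists 0 => C TC; case: no; exists C.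
exists (\sum_T ind T *~ c T); apply: functional_extensionality_dep => C.
rewrite -[LHS]/(VGeval C _) rmorph_mpeval raddf_sum /=.
set b := fun i => _; have indE T : mpeval b (ind T) = (T == [set i | x i C == 1]%SET)%:R.
  rewrite rmorph_prod /=; case: eqP => [->|/eqP TC].
    rewrite big1 // => i _; rewrite inE; case: eqP => [xi|xi]; first by rewrite mpevalX.
    rewrite rmorphB rmorph1 /= mpevalX /b /VGeval.
    by move: xi; rewrite /heaviside; case: asboolP.
  have : exists i, (i \in T) != (x i C == 1).
    apply: contra_notP (negP TC) => /forallNP h; apply/eqP/setP => i; rewrite inE.
    by apply/eqP; apply: contra_notT (h i) => /=.
  case=> i iT; apply/eqP; apply/prodf_eq0; exists i => //; move: iT.
  case: (i \in T); rewrite /= ?rmorphB ?rmorph1 /= mpevalX /b /VGeval /heaviside.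
    by case: asboolP.
  by case: asboolP.
rewrite (bigD1 [set i | x i C == 1]%SET) //= raddfMz /= indE eqxx hc big1 ?addr0 ?intz //.
by move=> T /negPf TC; rewrite raddfMz /= indE TC mul0rz.
Qed.

Lemma dependency_sign lam y : complement v y -> \sum_i lam i *: v i = 0 ->
  supp lam != finset.set0 -> (forall i, 0 < lam i -> 0 < dot (v i) y) ->
  (forall i, lam i < 0 -> ~~ (0 < dot (v i) y)) -> False.
Proof.
move=> cy lam0 /set0Pn[i0 i0l] pos neg.
have : dot (\sum_i lam i *: v i) y = 0 by rewrite lam0 dotC dot0r.
have term i : i \in supp lam -> 0 < lam i * dot (v i) y.
  rewrite inE; case: (ltgtP (lam i) 0) => // li _.
    by rewrite nmulr_rgt0 // lt_neqAle complement_dot //= leNgt neg.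
  by rewrite mulr_gt0 ?pos.
rewrite dot_suml (bigD1 i0) //= => /eqP; rewrite gt_eqF // ltr_pwDl ?term //.
apply: sumr_ge0 => i _; have [/term/ltW//|] := boolP (i \in supp lam).
by rewrite inE negbK => /eqP->; rewrite mul0r.
Qed.

(** A nonzero value would make a point of the chamber agree with all signs of a dependency. It
    covers the cone circuit relations and each product of a circuit relation, the negative ones
    through the opposite dependency. *)
Lemma circuit_vanish lam y (T T' : {set 'I_n}) : complement v y -> cone v W y ->
  \sum_i lam i *: v i = 0 -> supp lam != finset.set0 ->
  (forall i, 0 < lam i -> (i \in T) || (i \in W)) ->
  (forall i, lam i < 0 -> i \in T') ->
  mpeval (fun i => (0 < dot (v i) y)%R%:R : int)
    (emon T * \prod_(j in T') ('X_j - 1)) = 0.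
Proof.
move=> cy Wy lam0 slam pos neg; apply/eqP; apply/negPn/negP.
rewrite rmorphM /= mpeval_emon rmorph_prod /= mulf_eq0 negb_or => /andP[hT hT'].
apply: (dependency_sign cy lam0 slam) => i li.
  case/orP: (pos i li) => [iT|/Wy//]; move/prodf_neq0/(_ i iT): hT.
  by case: (0 < _).
move/prodf_neq0/(_ i (neg i li)): hT'.
by rewrite rmorphB rmorph1 /= mpevalX; case: (0 < _).
Qed.

Lemma relations_vanish g : relations v W g -> mpeval x g = 0.
Proof.
move=> Gg; apply: functional_extensionality_dep => C.
have [y [cy Wy _ xC]] := chamber_point C.
rewrite -[LHS]/(VGeval C _) rmorph_mpeval.
have -> : (fun i => VGeval C (x i)) = (fun i => (0 < dot (v i) y)%R%:R).
  by apply: functional_extensionality_dep => i; exact: xC.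
rewrite -[RHS]/(0 : int).
have neg_dep (lam : 'I_n -> R) : \sum_i lam i *: v i = 0 -> \sum_i (- lam i) *: v i = 0.
  by move=> h; under eq_bigr do rewrite scaleNr; rewrite sumrN h oppr0.
have neg_supp (lam : 'I_n -> R) : supp lam != finset.set0 -> supp (fun i => - lam i) != finset.set0.
  by move=> /set0Pn[i]; rewrite inE => li; apply/set0Pn; exists i; rewrite inE oppr_eq0.
case: Gg => [i|i iW|D Dc _ _|D Dc _ _|D Dc _].
- by rewrite rmorphB rmorphXn /= !mpevalX; case: (0 < _).
- by rewrite rmorphB rmorph1 /= mpevalX Wy.
- have ne0 : usupp D != finset.set0 by case: Dc.
  have [lam lam0 DE] := circuit_dependency Dc; move: ne0; rewrite DE usupp_sdep => ne0.
  by apply: (circuit_vanish cy Wy lam0 ne0) => i li; rewrite !inE ?li ?andbT ?orNb.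
- have ne0 : usupp D != finset.set0 by case: Dc.
  have [lam lam0 DE] := circuit_dependency Dc; move: ne0; rewrite DE usupp_sdep => ne0.
  apply: (circuit_vanish cy Wy (neg_dep _ lam0) (neg_supp _ ne0)) => i.
    by rewrite oppr_gt0 => li; rewrite !inE li andbT orNb.
  by rewrite oppr_lt0 => li; rewrite inE.
have ne0 : usupp D != finset.set0 by case: Dc.
have [lam lam0 DE] := circuit_dependency Dc; move: ne0; rewrite DE usupp_sdep => ne0.
rewrite rmorphB /= (circuit_vanish cy Wy lam0 ne0); last 2 first.
- by move=> i li; rewrite inE li.
- by move=> i li; rewrite inE.
rewrite (circuit_vanish cy Wy (neg_dep _ lam0) (neg_supp _ ne0)) ?subrr // => i.
  by rewrite oppr_gt0 => li; rewrite inE li.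
by rewrite oppr_lt0 => li; rewrite inE.
Qed.

End Chambers.

(** * A sign-reversing involution on subsets *)

Section Toggle.
Variable n : nat.
Implicit Types (a b : 'I_n) (N T : {set 'I_n}).

Definition toggle a T := if a \in T then T :\ a else a |: T.

Lemma toggleK a : involutive (toggle a).
Proof.
move=> T; rewrite /toggle; case: (boolP (a \in T)) => aT.
  by rewrite !inE eqxx /= finset.setD1K.
by rewrite !inE eqxx /= finset.setU1K.
Qed.

Lemma mem_toggle a T b : (b \in toggle a T) = if b == a then a \notin T else b \in T.
Proof.
by rewrite /toggle; case: (boolP (a \in T)) => aT; rewrite !inE; case: eqP => //= ->.
Qed.

Lemma sign_toggle a T : (-1) ^+ #|toggle a T| = - (-1) ^+ #|T| :> int.
Proof.
rewrite /toggle; case: (boolP (a \in T)) => aT.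
  by rewrite (cardsD1 a T) aT exprS mulN1r opprK.
by rewrite cardsU1 aT exprS mulN1r.
Qed.

Lemma toggle_sub a T N : a \in N -> (toggle a T \subset N) = (T \subset N).
Proof.
move=> aN; rewrite /toggle; case: ifP => aT.
  by rewrite -[in RHS](finset.setD1K aT) finset.subUset finset.sub1set aN.
by rewrite finset.subUset finset.sub1set aN.
Qed.

Lemma alternating_sum0 a (P : pred {set 'I_n}) (F : {set 'I_n} -> int) :
  (forall T, P (toggle a T) = P T) -> (forall T, F (toggle a T) = F T) ->
  \sum_(T | P T) (-1) ^+ #|T| * F T = 0.
Proof.
move=> Pa Fa; set s := \sum_(_ | _) _.
suff : s = - s by lia.
rewrite {1}/s (reindex_inj (inv_inj (toggleK a))) /= -sumrN.
by apply: eq_big => [T|T _]; rewrite ?Pa // sign_toggle Fa mulNr.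
Qed.

End Toggle.

(** * Functionals dual to the NBC monomials *)

Section Independence.
Variables (R : realType) (l n : nat) (v : 'I_n -> 'rV[R]_l) (W : {set 'I_n}).
Hypothesis v_neq0 : forall i, v i != 0.
Implicit Types (i a b : 'I_n) (N S T : {set 'I_n}).

Local Notation x := (heaviside v W).
Local Notation chamber := (set_type (chambers v W)).

(* The chambers [Ch T] surround the flat of N: they contain the points
   p + sum_b eps^(b+1) w_b + sum_(a in N) (+/-) eps^(D+1+a) u_a, where p lies in
   the flat and in the cone, the w_b form a basis of the flat, the u_a are dual
   to the v_a and the signs are - exactly for a in T.  The sign of v_i at such a
   point is that of the first nonzero coefficient in eps. *)
Lemma nbc_chambers N : N \in NBC v W ->
  exists (Ch : {set 'I_n} -> chamber) (lev : 'I_n -> option 'I_n) (sg : 'I_n -> bool),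
  [/\ forall i T, x i (Ch T) =
        (if lev i is Some a then (if a \in T then ~~ sg i else sg i) else sg i)%:R,
      forall i a, lev i = Some a -> a \in N /\ exists2 c : 'I_n -> R,
        v i = \sum_(b in N) c b *: v b &
        c a != 0 /\ forall b, b \in N -> (b < a)%N -> c b = 0 &
      forall i, i \in N -> lev i = Some i /\ sg i].
Proof.
move=> /NBCP[/NBC_indep indN [p pN Wp]].
pose X := flat v N; pose D := \dim X; pose w := vbasis X.
have [u hu] : exists u : 'I_n -> 'rV[R]_l, forall a, a \in N ->
    dot (v a) (u a) = 1 /\ forall b, b \in N -> b != a -> dot (v b) (u a) = 0.
  suff h a : exists u, a \in N ->
      dot (v a) u = 1 /\ forall b, b \in N -> b != a -> dot (v b) u = 0.
    by have [u hu] := choice h; exists u.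
  have [aN|aN] := boolP (a \in N); last by exists 0.
  by have [u u1 u2] := dual_vector indN aN; exists u.
(* The coefficient of the power [k] of the parameter; the last default 0 is reached only for [k] at
   least [D.+1 + n]. *)
pose z T k : 'rV[R]_l := if (k == 0)%N then p else if (k <= D)%N then w`_k.-1 else
  if insub (k - D.+1)%N is Some a then
    (if a \in N then (if a \in T then - u a else u a) else 0) else 0.
have zD T k : (k <= D)%N -> z T k = z finset.set0 k.
  by move=> kD; rewrite /z; case: eqP => // _; rewrite kD.
have za T a : z T (D.+1 + a)%N =
    if a \in N then (if a \in T then - u a else u a) else 0.
  by rewrite /z addSn /= ltnNge leq_addr /= subSS addKn valK.
pose K := (D.+1 + n)%N.
have lt_aK a : (D.+1 + a < K)%N by rewrite ltn_add2l.
have dotz T i k : dot (v i) (z T k) = dot (v i) (z finset.set0 k) \/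
    dot (v i) (z T k) = - dot (v i) (z finset.set0 k).
  have [kD|kD] := leqP k D; first by left; rewrite zD.
  rewrite /z; case: eqP => _; first by left.
  rewrite leqNgt kD /=; case: insubP => [a _ _|_]; last by left.
  rewrite finset.in_set0; case: ifP => _; last by left.
  by case: ifP => _; [right; rewrite -scaleN1r dotZr mulN1r|left].
have flatE i : (forall k, (k <= D)%N -> dot (v i) (z finset.set0 k) = 0) ->
    exists2 c : 'I_n -> R, v i = \sum_(b in N) c b *: v b &
      forall b, b \in N -> c b = dot (v i) (u b).
  move=> h; have : (X <= hyperplane v i)%VS.
    rewrite -(span_basis (vbasisP X)); apply/span_subvP => _ /(nthP 0)[k + <-].
    rewrite size_tuple => kD; rewrite mem_hyperplane.
    by have := h k.+1 kD; rewrite /z /= kD => ->.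
  move=> /flat_sub_hyperplane[c vi]; exists c => // b bN.
  rewrite [in RHS]vi dot_suml (bigD1 b) //= (hu b bN).1 mulr1 big1 ?addr0 // => a.
  by move=> /andP[aN ab]; rewrite ((hu b bN).2 a) ?mulr0.
(* [kk i] is the exponent of the leading coefficient, the same for all [T] because [T] only changes
   signs. It exists since a normal killed by all coefficients would be zero. *)
have [kk hkk] : exists kk : 'I_n -> nat, forall i, [/\ (kk i < K)%N,
    dot (v i) (z finset.set0 (kk i)) != 0 &
    forall j, (j < kk i)%N -> dot (v i) (z finset.set0 j) = 0].
  suff h i : exists k, [/\ (k < K)%N, dot (v i) (z finset.set0 k) != 0 &
      forall j, (j < k)%N -> dot (v i) (z finset.set0 j) = 0].
    by have [kk hkk] := choice h; exists kk.
  have ex : exists k, (k < K)%N && (dot (v i) (z finset.set0 k) != 0).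
    apply: contrapT => /forallNP no.
    have h k : (k < K)%N -> dot (v i) (z finset.set0 k) = 0.
      by move=> kK; apply/eqP; have /negP := no k; rewrite kK /= negbK.
    have [|c vi cE] := flatE i.
      by move=> k kD; apply: h; rewrite /K addSn ltnS (leq_trans kD) ?leq_addr.
    case/negP: (v_neq0 i); rewrite vi big1 // => b bN.
    by have := h _ (lt_aK b); rewrite za bN finset.in_set0 -cE // => ->; rewrite scale0r.
  case: (ex_minnP ex) => k /andP[kK nz] kmin; exists k; split=> // j jk.
  apply: contraTeq jk => nzj; rewrite -leqNgt; apply: kmin.
  rewrite nzj andbT ltnNge; apply: contra nzj => Kj.
  suff -> : z finset.set0 j = 0 by rewrite dot0r.
  rewrite /z; case: eqP => [j0|_]; first by move: Kj; rewrite j0.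
  have jD : (D < j)%N by apply: leq_trans Kj; rewrite /K addSn ltnS leq_addr.
  rewrite leqNgt jD /= insubF //; apply/negbTE; rewrite -leqNgt.
  by rewrite leq_subRL //; apply: leq_trans Kj.
pose P T i : {poly R} := \poly_(k < K) dot (v i) (z T k).
pose y T e := \sum_(k < K) e ^+ k *: z T k.
have PE T i e : (P T i).[e] = dot (v i) (y T e).
  rewrite horner_poly dot_sumr; apply: eq_bigr => k _.
  by rewrite dotZr mulrC.
(* The opposites are listed too, so that one [e] also controls the negative leading coefficients. *)
have [e e0 he] := horner_gt0_near0_seq
  ([seq P q.1 q.2 | q <- enum {: {set 'I_n} * 'I_n}] ++
   [seq - P q.1 q.2 | q <- enum {: {set 'I_n} * 'I_n}]).
have zlow T i j : (j < kk i)%N -> dot (v i) (z T j) = 0.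
  have [_ _ /(_ j) h] := hkk i => /h hz.
  by case: (dotz T i j) => ->; rewrite hz ?oppr0.
have znz T i : dot (v i) (z T (kk i)) != 0.
  have [_ nz _] := hkk i; by case: (dotz T i (kk i)) => ->; rewrite ?oppr_eq0.
have coP T i j : (j <= kk i)%N -> (P T i)`_j = dot (v i) (z T j).
  by have [kK _ _] := hkk i; move=> jk; rewrite coef_poly (leq_ltn_trans jk kK).
have sign T i : (0 < dot (v i) (y T e)) = (0 < dot (v i) (z T (kk i))) /\
    dot (v i) (y T e) != 0.
  have := znz T i; rewrite neq_lt => /orP[neg|pos].
    have : 0 < (- P T i).[e].
      apply: (he e _ _ _ (kk i)); first by rewrite e0 lexx.
      - by rewrite mem_cat (map_f (fun q => - P q.1 q.2) (mem_enum _ (T, i))) ?orbT.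
      - by move=> j jk; rewrite coefN coP ?zlow ?oppr0 // ltnW.
      - by rewrite coefN coP // oppr_gt0.
    rewrite hornerN oppr_gt0 PE => ney.
    by rewrite (lt_gtF ney) (lt_gtF neg) lt_eqF.
  have : 0 < (P T i).[e].
    apply: (he e _ _ _ (kk i)); first by rewrite e0 lexx.
    - by rewrite mem_cat (map_f (fun q => P q.1 q.2) (mem_enum _ (T, i))).
    - by move=> j jk; rewrite coP ?zlow // ltnW.
    - by rewrite coP.
  by rewrite PE => posy; rewrite posy pos gt_eqF.
have [Ch hCh] : exists Ch : {set 'I_n} -> chamber, forall T i,
    x i (Ch T) = (0 < dot (v i) (y T e))%R%:R.
  suff h T : exists C : chamber, forall i, x i C = (0 < dot (v i) (y T e))%R%:R.
    by have [Ch hCh] := choice h; exists Ch.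
  apply: point_chamber => [i|i iW]; first by rewrite mem_hyperplane (sign T i).2.
  rewrite /halfspace /= (sign T i).1.
  (* For [i] in [W] the constant term [dot (v i) p] is positive, so the perturbed point stays in the
     cone. *)
  suff -> : kk i = 0%N by rewrite /z /=; exact: Wp.
  apply/eqP; rewrite -leqn0 leqNgt; apply/negP => /(zlow finset.set0).
  by rewrite /z /= => h; have := Wp i iW; rewrite /halfspace /= h ltxx.
have kkD i : (D < kk i)%N -> exists2 a : 'I_n, kk i = (D.+1 + a)%N & a \in N.
  move=> Dk; have [kK nz _] := hkk i.
  have lt_n : (kk i - D.+1 < n)%N by rewrite ltn_subLR.
  have kE : kk i = (D.+1 + Ordinal lt_n)%N by rewrite /= subnKC.
  exists (Ordinal lt_n) => //; apply: contraNT nz => aN.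
  by rewrite kE za (negPf aN) dot0r.
(* The level is [None] when [p] or a direction inside the flat decides the sign, which [T] then
   cannot change; [sg] records the signs for [T] empty. *)
exists Ch, (fun i => if (kk i <= D)%N then None else insub (kk i - D.+1)%N),
  (fun i => 0 < dot (v i) (z finset.set0 (kk i))); split.
- move=> i T; rewrite hCh (sign T i).1; have [kD|kD] := leqP (kk i) D.
    by rewrite zD.
  have [a ka aN] := kkD i kD; rewrite ka addKn valK !za aN finset.in_set0.
  case: ifP => // _; rewrite -scaleN1r dotZr mulN1r oppr_gt0.
  by have := znz finset.set0 i; rewrite ka za aN finset.in_set0; case: ltgtP.
- move=> i a; have [//|kD] := leqP (kk i) D.
  have [a' ka aN] := kkD i kD; rewrite ka addKn valK => -[<-] {a}.
  split=> //; have [|c vi cE] := flatE i.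
    by move=> k kD'; apply: zlow; exact: leq_ltn_trans kD' kD.
  exists c => //; split.
    by have := znz finset.set0 i; rewrite ka za aN finset.in_set0 cE.
  move=> b bN ba; have := zlow finset.set0 i (D.+1 + b)%N.
  by rewrite ka ltn_add2l za bN finset.in_set0 cE //; apply.
move=> i iN.
have kE : kk i = (D.+1 + i)%N.
  have low k : (k < D.+1 + i)%N -> dot (v i) (z finset.set0 k) = 0.
    have [kD _|kD ki] := leqP k D.
      apply: (flatP v N _ _ i iN); rewrite /z; case: eqP => [//|/eqP k0]; rewrite kD.
      by apply: vbasis_mem; rewrite mem_nth // size_tuple prednK // lt0n.
    rewrite /z gtn_eqF ?(leq_ltn_trans _ kD) // leqNgt kD /=.
    case: insubP => [a _ av|_]; last by rewrite dot0r.
    rewrite finset.in_set0; case: ifP => aN; last by rewrite dot0r.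
    apply: (hu a aN).2 => //; apply: contraTneq ki => ->.
    by rewrite -leqNgt av subnKC.
  have [kK nz mink] := hkk i; apply/eqP; rewrite eqn_leq; apply/andP; split.
    rewrite leqNgt; apply/negP => /mink; rewrite za iN finset.in_set0 (hu i iN).1.
    by move/eqP; rewrite oner_eq0.
  by rewrite leqNgt; apply: contra nz => /low->.
rewrite kE leqNgt ltnS leq_addr /= addKn valK; split=> //.
by rewrite za iN finset.in_set0 (hu i iN).1.
Qed.

(** An iterated difference: toggling [a] affects only factors of level [a], so a product survives
    only if its factors attain every level in [N]. *)
Lemma nbc_functional N : N \in NBC v W ->
  exists rho : {additive VG v W -> int},
  [/\ forall s : seq 'I_n, (size s < #|N|)%N -> rho (\prod_(i <- s) x i) = 0,
      rho (\prod_(i in N) x i) = 1 &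
      forall S, S \in NBC v W -> #|S| = #|N| -> S != N ->
        rho (\prod_(i in S) x i) = 0].
Proof.
move=> NN; have [Ch [lev [sg [xCh levP levN]]]] := nbc_chambers NN.
pose rho (f : VG v W) : int := \sum_(T : {set 'I_n} | T \subset N) (-1) ^+ #|T| * f (Ch T).
have rho_add : zmod_morphism rho.
  by move=> f g; rewrite /rho -sumrB; apply: eq_bigr => T _; rewrite -mulrBr.
pose rhoA := HB.pack_for {additive VG v W -> int} rho
  (GRing.isZmodMorphism.Build _ _ rho rho_add).
have prodCh s T : (\prod_(i <- s) x i : VG v W) (Ch T) = \prod_(i <- s) x i (Ch T).
  exact: (rmorph_prod (VGeval (Ch T))).
have prodChS S T : (\prod_(i in S) x i : VG v W) (Ch T) = \prod_(i in S) x i (Ch T).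
  exact: (rmorph_prod (VGeval (Ch T))).
have kill s a : a \in N -> (forall i, i \in s -> lev i <> Some a) ->
    rho (\prod_(i <- s) x i) = 0.
  move=> aN nota; apply: (@alternating_sum0 _ a) => T; first exact: toggle_sub.
  rewrite !prodCh big_seq [RHS]big_seq; apply: eq_bigr => i /nota ia; rewrite !xCh.
  case: (lev i) ia => // b ba; rewrite mem_toggle.
  by case: (eqVneq b a) ba => [->|].
exists rhoA; split.
- move=> s ss; suff [a aN sa] : exists2 a, a \in N & forall i, i \in s -> lev i <> Some a.
    exact: (kill s a).
  apply: contrapT => no; have {}no a : a \in N -> Some a \in [seq lev i | i <- s].
    move=> aN; apply: contrapT => /negP na; apply: no; exists a => // i si ia.
    by case/negP: na; rewrite -ia map_f.
  have : (#|N| <= size s)%N.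
    rewrite -(size_map lev) cardE -(size_map Some); apply: uniq_leq_size.
      by rewrite map_inj_uniq ?enum_uniq // => ? ? [].
    by move=> _ /mapP[a + ->]; rewrite mem_enum => /no.
  by rewrite leqNgt ss.
- rewrite -[LHS]/(rho _) /rho (bigD1 finset.set0) ?finset.sub0set //= cards0 expr0 mul1r.
  rewrite prodChS big1 => [|i iN]; last first.
    by rewrite xCh (levN i iN).1 (levN i iN).2 finset.in_set0.
  rewrite big1 ?addr0 // => T /andP[TN T0]; case/set0Pn: T0 => a aT.
  have aN := fintype.subsetP TN a aT.
  rewrite prodChS (bigD1 a) //= xCh (levN a aN).1 (levN a aN).2 aT.
  by rewrite mul0r mulr0.
move=> S SN cS neq; rewrite -[LHS]/(rho _) -big_enum.
apply: contrapT => nz; have lev_surj a : a \in N -> exists2 i, i \in S & lev i = Some a.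
  move=> aN; apply: contrapT => no; apply: nz; apply: (kill _ a) => // i.
  by rewrite mem_enum => iS ia; apply: no; exists i.
have [/NBCP[nbcN _] /NBCP[nbcS _]] := (NN, SN).
(* With [a] the largest element of [N] outside [S], all larger elements of [N] lie in [S]. An [i] in
   [S] of level [a] then contradicts the NBC property of [N] if [i < a], and that of [S] if
   [i > a]. *)
have [a0 a0N a0S] : exists2 a, a \in N & a \notin S.
  apply/fintype.subsetPn; apply: contra neq => NS.
  by rewrite eq_sym finset.eqEcard NS cS leqnn.
have Pa0 : (a0 \in N) && (a0 \notin S) by rewrite a0N.
case: (@arg_maxnP _ a0 [pred a | (a \in N) && (a \notin S)] (fun a => a : nat) Pa0).
move=> a /= /andP[aN aS] amax.
have [i iS /levP[_ [c vi [ca0 clow]]]] := lev_surj a aN.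
have [ia|ai|/val_inj ia] := ltngtP i a; last by move: aS; rewrite -ia iS.
  apply: (NBC_notin_span nbcN (i := i)); rewrite vi.
  apply: in_span_comb => b bN cb; apply: in_span_gen; rewrite inE bN /=.
  by apply: leq_trans ia _; rewrite leqNgt; apply: contra cb => /(clow b bN)->.
(* Solving the expansion of [v i] for [v a] leaves [v i] and vectors [v b] with [b] in [N] above
   [a], hence in [S]. *)
apply: (NBC_notin_span nbcS (i := a)).
have -> : v a = (c a)^-1 *: (v i + (-1) *: \sum_(b in N :\ a) c b *: v b).
  rewrite vi (big_setD1 a aN) /= scaleN1r addrK scalerA mulVf // scale1r //.
apply: in_spanZ; apply: in_spanD; first by apply: in_span_gen; rewrite inE iS.
apply: in_spanZ; apply: in_span_comb => b; rewrite in_setD1 => /andP[ba bN] cb.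
have lt_ab : (a < b)%N.
  rewrite ltn_neqAle leqNgt; apply/andP; split.
    by apply: contraNneq ba => /val_inj ->.
  by apply: contra cb => /(clow b bN)->.
apply: in_span_gen; rewrite inE lt_ab andbT.
by apply: contrapT => /negP bS; have := amax b; rewrite bN bS leqNgt lt_ab => /(_ isT).
Qed.

End Independence.

(** * Integral rank and the isomorphism criterion *)

(** With more vectors than generators the coefficient matrix has a nonzero rational left kernel;
    clearing denominators yields an integral relation. *)
Lemma Zindependent_le_span (M : zmodType) r k (g : 'I_r -> M) (b : 'I_k -> M) :
  (forall m, exists c : 'I_r -> int, m = \sum_i g i *~ c i) ->
  Zindependent [set: 'I_k]%SET b -> (k <= r)%N.
Proof.
move=> spang indb; have [c hc] := choice (fun j => spang (b j)).
rewrite leqNgt; apply/negP => lt_rk.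
pose A : 'M[rat]_(k, r) := \matrix_(j, i) (c j i)%:~R.
have : kermx A != 0.
  by rewrite kermx_eq0 /row_free; apply: contraTneq lt_rk => <-; rewrite -leqNgt rank_leq_col.
move=> /rowV0Pn[u /sub_kermxP uA u0].
pose d : int := \prod_j denq (u 0 j).
have dnz : d%:~R != 0 :> rat.
  by rewrite intr_eq0; apply/prodf_neq0 => j _; exact: denq_neq0.
pose m j : int := numq (u 0 j) * \prod_(j' | j' != j) denq (u 0 j').
have mE j : (m j)%:~R = d%:~R * u 0 j.
  have dE : d = denq (u 0 j) * \prod_(j' | j' != j) denq (u 0 j') by rewrite /d (bigD1 j).
  by rewrite /m dE !rmorphM /= numqE; ring.
have rel i : \sum_j c j i * m j = 0.
  apply: (@intr_inj rat); rewrite rmorph_sum rmorph0 /=.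
  move/matrixP/(_ 0 i): uA; rewrite !mxE => uA.
  transitivity (d%:~R * \sum_j u 0 j * A j i); last by rewrite uA mulr0.
  rewrite mulr_sumr; apply: eq_bigr => j _.
  by rewrite rmorphM /= mE mxE mulrC mulrA.
have : forall j, j \in [set: 'I_k]%SET -> m j = 0.
  apply: indb; rewrite (eq_bigl xpredT) => [|j]; last by rewrite inE.
  under eq_bigr => j _.
    rewrite hc mulrz_suml.
    under eq_bigr do rewrite -mulrzA.
    over.
  rewrite exchange_big big1 //= => i _.
  by rewrite -mulrz_sumr rel mulr0z.
move=> m0; case/negP: u0; apply/eqP/matrixP => a j; rewrite ord1 [RHS]mxE.
by apply: (mulfI dnz); rewrite -mE m0 ?inE // mulr0 mulr0z.
Qed.

Section QuotientIso.
Variables (R : realType) (l n : nat) (v : 'I_n -> 'rV[R]_l) (W : {set 'I_n}).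
Variables (B : comPzRingType) (K : set {mpoly int[n]}).
Variable phi : {rmorphism {mpoly int[n]} -> B}.

(** Spanning writes a kernel element through NBC monomials, and independence of their images kills
    its coefficients. Both isomorphisms are instances. *)
Lemma quotient_iso :
    (forall g, K g -> phi g = 0) -> (forall b, exists p, phi p = b) ->
    (forall p, p \in nbc_span v W K) ->
    Zindependent (NBC v W) (fun N => phi (emon N)) ->
  exists f : {rmorphism quot_ring K -> B},
    [/\ bijective f, forall p, f (qclass K p) = phi p &
        Zbasis (NBC v W) (fun N => f (qclass K (emon N)))].
Proof.
move=> phiK surj span indep; have [f fE] := qlift_rmorphism phiK.
have phi_ideal p : p \in ideal_gen K -> phi p = 0.
  move=> /asboolP[s [Ks ->]]; rewrite rmorph_sum big_seq big1 // => q /Ks Kq.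
  by rewrite rmorphM (phiK _ Kq) mulr0.
have phi_span p c : p - \sum_(N in NBC v W) emon N *~ c N \in ideal_gen K ->
    phi p = \sum_(N in NBC v W) phi (emon N) *~ c N.
  move=> /phi_ideal/eqP; rewrite rmorphB subr_eq0 rmorph_sum => /eqP ->.
  by apply: eq_bigr => N _; rewrite rmorphMz.
have f_inj : injective f.
  suff ker q : f q = 0 -> q = 0.
    by move=> q q' /eqP; rewrite -subr_eq0 -rmorphB => /eqP/ker/eqP; rewrite subr_eq0 => /eqP.
  have [p <-] := qclass_surj q; rewrite fE => p0.
  have [c hc] := nbc_spanP (span p).
  have c0 : forall N, N \in NBC v W -> c N = 0 by apply: indep; rewrite -(phi_span p c).
  have -> : 0 = qclass K 0 :> quot_ring K.
    by apply: (addrI (qclass K 0)); rewrite -qclassD !addr0.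
  apply/qclassE; rewrite subr0; move: hc; rewrite big1 ?subr0 // => N /c0->.
  by rewrite mulr0z.
have [g gK] : exists g, forall b, f (g b) = b.
  suff h b : exists q, f q = b by have [g] := choice h; exists g.
  by have [p <-] := surj b; exists (qclass K p).
exists f; split=> //.
  by exists g => // q; apply: f_inj; rewrite gK.
split=> [c|b].
  under eq_bigr do rewrite fE.
  exact: indep.
have [p <-] := surj b; have [c /phi_span->] := nbc_spanP (span p); exists c.
by under [RHS]eq_bigr do rewrite fE.
Qed.

End QuotientIso.

(** * NBC bases and the Hilbert series *)

Section Bases.
Variables (R : realType) (l n : nat) (v : 'I_n -> 'rV[R]_l) (W : {set 'I_n}).
Hypothesis v_neq0 : forall i, v i != 0.

Local Notation x := (heaviside v W).
Local Notation xmon N := (\prod_(i in N) x i).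
Local Notation gx := (fun i => gr_in x 1 (x i)).

Lemma filt_prev_indep d (c : {set 'I_n} -> int) :
  \sum_(N in NBC v W | #|N| == d) xmon N *~ c N \in filt_prev x d ->
  forall N, N \in NBC v W -> #|N| = d -> c N = 0.
Proof.
move=> low N NN Nd; have [rho [rho_low rhoN rho_other]] := nbc_functional v_neq0 NN.
have rho_prev a : a \in filt_prev x d -> rho a = 0.
  case: d Nd {low} => [_ /eqP->|d Nd]; first exact: raddf0.
  move=> /asboolP[s [gen ->]]; rewrite raddf_sum big_seq big1 // => q /gen[t st ->].
  by rewrite raddfMz /= rho_low ?mul0rz // Nd ltnS.
have := rho_prev _ low; rewrite raddf_sum (bigD1 N) ?NN ?Nd //= raddfMz rhoN intz.
rewrite big1 ?addr0 // => S /andP[/andP[SN /eqP Sd] neq].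
by rewrite raddfMz rho_other ?mul0rz // Nd.
Qed.

Lemma xmon_filt (N : {set 'I_n}) d : (#|N| <= d)%N -> xmon N \in filt x d.
Proof. by move=> Nd; apply: Zspan_gen; exists (enum N); rewrite -?cardE ?big_enum. Qed.

(** For [N] of maximal size among the nonzero coefficients, the terms of size [#|N|] sum to an
    element one filtration step lower, which [filt_prev_indep] forbids. *)
Lemma VG_indep : Zindependent (NBC v W) (fun N => mpeval x (emon N)).
Proof.
move=> c sum0; apply: contrapT => /existsNP[N0 /not_implyP[N0N cN0]].
have P0 : (N0 \in NBC v W) && (c N0 != 0) by rewrite N0N; exact/eqP.
case: (@arg_maxnP _ N0 [pred N | (N \in NBC v W) && (c N != 0)] (fun N => #|N|) P0).
move=> N /= /andP[NN cN] Nmax; case/negP: cN; apply/eqP.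
apply: (filt_prev_indep _ NN erefl).
move/eqP: sum0; rewrite (bigID (fun N' : {set 'I_n} => #|N'| == #|N|)) /= addr_eq0 => /eqP.
under eq_bigr do rewrite mpeval_emon.
move=> ->; rewrite rpredN; apply: rpred_sum => S /andP[SN neq].
have [->|cS] := eqVneq (c S) 0; first by rewrite mulr0z rpred0.
have lt_SN : (#|S| < #|N|)%N by rewrite ltn_neqAle neq; apply: Nmax; rewrite SN.
rewrite rpredMz // mpeval_emon; case: #|N| lt_SN => // d lt_d.
exact: xmon_filt.
Qed.

(** A relation vanishes in [VG v W], so its initial form takes the opposite of the value of its
    lower-order part, one step down in the filtration. *)
Lemma in_deg_vanish g : (@in_deg n @` relations v W) g -> mpeval gx g = 0.
Proof.
move=> [h /relations_vanish h0 <-]; rewrite (mpeval_gr_homog x (in_deg_homog h)).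
apply/gr_in_eq0; first exact: mpeval_filt (dhomog_msize_le (in_deg_homog h)).
have -> : mpeval x (in_deg h) = - mpeval x (h - in_deg h).
  by rewrite rmorphB /= h0 sub0r opprK.
(* In degree 0 the previous filtration step is zero, and so is the lower-order part. *)
rewrite rpredN; have := msize_sub_in_deg h; case: (msize h).-1 => [|d].
  by rewrite leqn0 mmeasure_poly_eq0 => /eqP->; rewrite raddf0 rpred0.
exact: mpeval_filt.
Qed.

Lemma mpeval_gr_emon (N : {set 'I_n}) : mpeval gx (emon N) = gr_in x #|N| (xmon N).
Proof. by rewrite (mpeval_gr_homog x (emon_homog N)) mpeval_emon. Qed.

Lemma component_gr_emon (c : {set 'I_n} -> int) d :
  (\sum_(N in NBC v W) mpeval gx (emon N) *~ c N : graded x) d =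
  \sum_(N in NBC v W | #|N| == d) gr_class x d (xmon N) *~ c N.
Proof.
rewrite component_sum big_mkcondr /=; apply: eq_bigr => N _.
rewrite component_mulrz mpeval_gr_emon gr_inE eq_sym.
by case: eqP => // _; rewrite mul0rz.
Qed.

Lemma gr_indep d (c : {set 'I_n} -> int) :
  \sum_(N in NBC v W | #|N| == d) gr_class x d (xmon N) *~ c N = 0 ->
  forall N, N \in NBC v W -> #|N| = d -> c N = 0.
Proof.
move=> sum0; apply: filt_prev_indep.
have F (N : {set 'I_n}) : (N \in NBC v W) && (#|N| == d) -> xmon N *~ c N \in filt x d.
  by move=> /andP[_ /eqP Nd]; rewrite rpredMz // xmon_filt ?Nd.
apply/gr_in_eq0; first exact: rpred_sum.
rewrite gr_in_sum //; apply: gradedP => e; rewrite component_sum.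
rewrite -[RHS]/(0 : gr x e); have [->|ne] := eqVneq e d.
  rewrite -[RHS]sum0; apply: eq_bigr => N /andP[_ /eqP Nd].
  by rewrite gr_inMz ?xmon_filt ?Nd // component_mulrz gr_inE eqxx.
rewrite big1 // => N _; by rewrite gr_inE (negPf ne).
Qed.

Lemma graded_indep : Zindependent (NBC v W) (fun N => mpeval gx (emon N)).
Proof.
move=> c sum0 N NN; apply: (@gr_indep #|N| c) => //.
by rewrite -component_gr_emon sum0.
Qed.

Lemma gr_span d (u : gr x d) : exists c : {set 'I_n} -> int,
  u = \sum_(N in NBC v W | #|N| == d) gr_class x d (xmon N) *~ c N.
Proof.
have [p hp] := mpeval_gr_surj (gr_in x d (gr_repr u)).
have [c hc] := nbc_spanP (nbc_span_in_deg v W p); exists c.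
have : mpeval gx (p - \sum_(N in NBC v W) emon N *~ c N) = 0.
  case/asboolP: hc => s [Ks ->]; rewrite rmorph_sum big_seq big1 // => q /Ks Kq.
  by rewrite rmorphM /= (in_deg_vanish Kq) mulr0.
move/eqP; rewrite rmorphB subr_eq0 /= hp rmorph_sum /= => /eqP.
under eq_bigr do rewrite rmorphMz /=.
move/(congr1 (fun g : graded x => g d)); rewrite component_gr_emon => <-.
by rewrite gr_inE eqxx gr_reprK.
Qed.

Lemma NBC_poly_coef d : (NBC_poly v W)`_d = #|[set N in NBC v W | #|N| == d]%SET|.
Proof.
rewrite coef_sum -sum1_card big_mkcond [RHS]big_mkcond; apply: eq_bigr => N _.
by rewrite inE coefXn eq_sym; case: (N \in _) => //; case: eqP.
Qed.

Lemma NBC_Hilb : is_Hilb v W (NBC_poly v W).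
Proof.
move=> d; rewrite NBC_poly_coef; set A := [set N in _ | _]%SET.
have sumA (c : {set 'I_n} -> int) :
    \sum_(i < #|A|) gr_class x d (xmon (enum_val i)) *~ c (enum_val i) =
    \sum_(N in NBC v W | #|N| == d) gr_class x d (xmon N) *~ c N.
  transitivity (\sum_(N in A) gr_class x d (xmon N) *~ c N); first by rewrite [RHS]big_enum_val.
  by apply: eq_bigl => N; rewrite inE.
split.
  exists (fun i : 'I_#|A| => gr_class x d (xmon (enum_val i))) => c sum0 i _.
  pose c' N := c (enum_rank_in (enum_valP i) N).
  have c'E j : c' (enum_val j) = c j by rewrite /c' enum_valK_in.
  have := enum_valP i; rewrite inE => /andP[iN /eqP id].
  rewrite -c'E; apply: (@gr_indep d c') => //; rewrite -sumA -[RHS]sum0.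
  by apply: eq_big => [j|j _]; rewrite ?inE ?c'E.
move=> k b; apply: (@Zindependent_le_span _ _ _
  (fun i : 'I_#|A| => gr_class x d (xmon (enum_val i)))) => u.
by have [c ->] := gr_span u; exists (fun i => c (enum_val i)); rewrite sumA.
Qed.

End Bases.

(** * The Möbius function through NBC sets *)

Section Poincare.
Variables (R : realType) (l n : nat) (v : 'I_n -> 'rV[R]_l) (W : {set 'I_n}).
Hypothesis v_neq0 : forall i, v i != 0.
Implicit Types (X Z : {vspace 'rV[R]_l}) (N T : {set 'I_n}).

Local Notation L := (Lint v W).

Lemma Lint_uniq : uniq L.
Proof. by rewrite filter_uniq // undup_uniq. Qed.

Lemma Lint_flat X : X \in L -> exists2 J, X = flat v J &
  exists2 y, y \in X & cone v W y.
Proof.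
by rewrite mem_filter mem_undup => /andP[/asboolP h /mapP[J _ XJ]]; exists J.
Qed.

Lemma Lint_above X N : X \in L -> (X <= flat v N)%VS -> flat v N \in L.
Proof.
move=> /Lint_flat[J _ [y yX Wy]] /subvP XN; apply/LintP.
by exists y => //; exact: XN.
Qed.

Lemma NBC_Lint N : N \in NBC v W -> flat v N \in L.
Proof. by rewrite inE => /asboolP[]. Qed.

Lemma NBC_mem N : is_NBC v N -> flat v N \in L -> N \in NBC v W.
Proof. by move=> h1 h2; rewrite inE; apply/asboolP. Qed.

(** Only a zero normal could make the empty set a broken circuit. *)
Lemma is_NBC0 : is_NBC v finset.set0.
Proof.
move=> B [C [i [Cc iC _ ->]]]; apply/negP; rewrite finset.subset0 => /eqP C0.
have := circuit_span Cc iC; rewrite C0 => -[lam]; rewrite big_set0 => vi.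
by have := v_neq0 i; rewrite vi eqxx.
Qed.

Lemma NBC_codim N : is_NBC v N -> (l - \dim (flat v N))%N = #|N|.
Proof. by move=> /NBC_indep/dim_flat dimN; rewrite -(addKn (\dim (flat v N)) #|N|) dimN. Qed.

Lemma sum_by_flat (V : nmodType) (P : pred {vspace 'rV[R]_l}) (F : {set 'I_n} -> V) :
  \sum_(Z <- L | P Z) \sum_(N in NBC v W | flat v N == Z) F N =
  \sum_(N in NBC v W | P (flat v N)) F N.
Proof.
rewrite (exchange_big_dep (mem (NBC v W))) => [|Z N _ /andP[]//].
rewrite [RHS]big_mkcondr; apply: eq_bigr => N /= NN.
rewrite big_mkcond (bigD1_seq (flat v N)) ?NBC_Lint ?Lint_uniq //= eqxx andbT NN andbT.
by rewrite big1 ?addr0 // => Z /negPf ZN; rewrite eq_sym ZN !andbF.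
Qed.

Lemma NBC_fullv N : fullv \in L ->
  (N \in NBC v W) && (flat v N == fullv) = (N == finset.set0).
Proof.
move=> fullL; apply/andP/eqP => [[/NBCP[nbcN _] /eqP fN]|->].
  by apply/eqP; rewrite -cards_eq0 -NBC_codim // fN dimvf /dim /= mul1n subnn.
by rewrite flat0 eqxx; split=> //; apply: NBC_mem; rewrite ?flat0 //; exact: is_NBC0.
Qed.

(* Adding or removing the smallest index whose hyperplane contains X preserves
   the NBC sets with flat above X. *)
Lemma NBC_toggle X : X \in L -> X != fullv ->
  exists i, forall N, (N \in NBC v W) && (X <= flat v N)%VS ->
    (toggle i N \in NBC v W) && (X <= flat v (toggle i N))%VS.
Proof.
move=> XL Xfull; have [J XJ _] := Lint_flat XL.
have [j jJ] : exists j, (X <= hyperplane v j)%VS.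
  have [J0|[j jJ]] := set_0Vmem J; last by exists j; rewrite XJ flat_hyperplane.
  by move: Xfull; rewrite XJ J0 flat0 eqxx.
case: (@arg_minnP _ j [pred j | (X <= hyperplane v j)%VS] (fun j => j : nat) jJ).
move=> i /= iX imin; exists i => N /andP[NN XN].
have XN' : (X <= flat v (toggle i N))%VS.
  apply/subvP => y yX; apply/flatP => a; rewrite mem_toggle.
  case: eqP => [-> _|_ aN]; first by apply/eqP; rewrite -mem_hyperplane (subvP iX).
  by apply: (flatP v N y _ a aN); exact: (subvP XN).
rewrite XN' andbT; apply: NBC_mem (Lint_above XL XN').
have [nbcN _] := NBCP _ _ _ NN; rewrite /toggle; case: ifP => iN.
  by apply: NBC_sub nbcN; exact: subD1set.
(* A broken circuit in [i |: N] must contain [i]. Its removed minimum [m] has [v m] in the span of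
   normals vanishing on [X], so minimality gives [i <= m], although [m < i]. *)
move=> B [C [m [Cc mC mmin ->]]]; apply/negP => CN.
have [iC|iC] := boolP (i \in usupp C :\ m); last first.
  have : broken_circuit v (usupp C :\ m) by exists C, m.
  move/nbcN/negP; apply; apply/fintype.subsetP => a aC.
  have := fintype.subsetP CN a aC; rewrite in_setU1 => /orP[/eqP ai|//].
  by move: iC; rewrite -ai aC.
move: iC; rewrite in_setD1 => /andP[im iC].
suff : (i <= m)%N.
  rewrite leqNgt ltn_neqAle mmin // andbT negbK => /eqP/val_inj mi.
  by rewrite mi eqxx in im.
apply: imin; apply/subvP => y yX; rewrite mem_hyperplane.
have [lam ->] := circuit_span Cc mC; rewrite dot_suml big1 // => a aC.
have := fintype.subsetP CN a aC; rewrite in_setU1 => /orP[/eqP->|aN].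
  by have := subvP iX y yX; rewrite mem_hyperplane => /eqP->; rewrite mulr0.
by rewrite (flatP v N y (subvP XN y yX) a aN) mulr0.
Qed.

Lemma NBC_alternating X : X \in L -> X != fullv ->
  \sum_(N in NBC v W | (X <= flat v N)%VS) (-1) ^+ #|N| = 0 :> int.
Proof.
move=> XL Xfull; have [i tog] := NBC_toggle XL Xfull.
under eq_bigr do rewrite -[(-1) ^+ _]mulr1.
apply: (@alternating_sum0 n i _ (fun=> 1)) => // N.
apply/idP/idP; last exact: tog.
by move/tog; rewrite toggleK.
Qed.

(** The NBC sums satisfy the recursion of [mobius_rec], and the fuel suffices when it bounds the
    number of flats strictly containing [X]: passing to such a flat [Z] loses at least [Z] from that
    count. *)
Lemma mobius_NBC k X : X \in L ->
    (count (fun Z => (X <= Z)%VS && (Z != X)) L <= k)%N ->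
  mobius_rec L (fun X Y => (Y <= X)%VS) k fullv X =
  \sum_(N in NBC v W | flat v N == X) (-1) ^+ #|N|.
Proof.
elim: k X => [|k IH] X XL countk.
all: have fullL : fullv \in L
  by rewrite -(flat0 v); apply: Lint_above XL _; rewrite flat0 subvf.
all: have [fX|fX] := eqVneq fullv X; [|rewrite /= (negPf fX)].
- rewrite -fX /= eqxx (big_pred1 finset.set0) ?cards0 // => N.
  exact: NBC_fullv.
- move: countk; rewrite leqn0 => /eqP/eqP; rewrite -leqn0 leqNgt -has_count.
  by move/negP; case; apply/hasP; exists fullv => //; rewrite subvf.
- rewrite -fX /= eqxx (big_pred1 finset.set0) ?cards0 // => N.
  exact: NBC_fullv.
have := NBC_alternating XL; rewrite eq_sym => /(_ fX).
rewrite -(sum_by_flat (fun Z => (X <= Z)%VS)) (bigID (fun Z => Z == X)) /=.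
move/eqP; rewrite addr_eq0 => /eqP.
have -> : \sum_(Z <- L | (X <= Z)%VS && (Z == X)) \sum_(N in NBC v W | flat v N == Z) (-1) ^+ #|N|
    = \sum_(N in NBC v W | flat v N == X) (-1) ^+ #|N| :> int.
  rewrite big_mkcond (bigD1_seq X) ?Lint_uniq //= subvv eqxx /=.
  by rewrite [X in _ + X]big1 ?addr0 // => Z /negPf->; rewrite andbF.
move=> ->; congr (- _); rewrite big_seq_cond [RHS]big_seq_cond.
apply: eq_big => [Z|Z /andP[ZL /and3P[_ XZ neq]]]; first by rewrite subvf.
apply: IH => //; rewrite -ltnS; apply: leq_trans countk.
rewrite -add1n; apply: leq_trans (_ : count (pred1 Z) L +
  count (fun Y => (Z <= Y)%VS && (Y != Z)) L <= _)%N.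
  by rewrite leq_add2r -has_count has_pred1.
rewrite -count_predUI addnC (_ : count (predI _ _) _ = 0%N) ?add0n; last first.
  apply/eqP; rewrite eqn0Ngt -has_count; apply/hasPn => Y _ /=.
  by case: eqP => //= _; rewrite andbF.
apply: sub_count => Y /= /orP[/eqP->|/andP[ZY nY]]; first by rewrite XZ.
rewrite (subv_trans XZ ZY) /=; apply: contra nY => /eqP YX.
by rewrite YX in ZY *; rewrite eqEsubv XZ ZY.
Qed.

(** NBC sets with the same flat have as many elements as its codimension, so their signs agree and
    the absolute value of the Möbius function counts them. *)
Lemma NBC_poly_Poin : NBC_poly v W = Poin v W.
Proof.
rewrite /NBC_poly /Poin.
transitivity (\sum_(N in NBC v W | xpredT (flat v N)) 'X^#|N| : {poly nat}).
  by apply: eq_bigl => N; rewrite andbT.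
rewrite -(sum_by_flat xpredT) big_seq [RHS]big_seq; apply: eq_bigr => X XL.
rewrite /mobius mobius_NBC //; last exact: count_size.
have cod N : (N \in NBC v W) && (flat v N == X) -> #|N| = (l - \dim X)%N.
  by move=> /andP[/NBCP[nbcN _] /eqP <-]; rewrite NBC_codim.
rewrite (eq_bigr (fun=> 'X^(l - \dim X))) => [|N /cod->//].
rewrite [in RHS](eq_bigr (fun=> (-1) ^+ (l - \dim X))) => [|N /cod->//].
pose A := [set N in NBC v W | flat v N == X]%SET.
have AE N : (N \in NBC v W) && (flat v N == X) = (N \in A) by rewrite [RHS]inE.
have -> : \sum_(N in NBC v W | flat v N == X) (-1) ^+ (l - \dim X) =
    (-1) ^+ (l - \dim X) * #|A|%:Z.
  by rewrite (eq_bigl _ _ AE) sumr_const -mulr_natr natz.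
by rewrite (eq_bigl _ _ AE) sumr_const abszM abszX /= exp1n mul1n.
Qed.

End Poincare.

Theorem theorem1p1 (R : realType) (l n : nat) (v : 'I_n -> 'rV[R]_l)
    (W : {set 'I_n}) (prec : rel 'X_{1..n})
    (v_neq0 : forall i, v i != 0) (hyperplane_inj : injective (hyperplane v))
    (prec_order : monomial_order prec) (prec_deg : refines_degree prec) :
  [/\ exists f : {rmorphism quot_ring (relations v W) -> VG v W},
        [/\ bijective f,
            forall i, f (qclass (relations v W) 'X_i) = heaviside v W i &
            Zbasis (NBC v W) (fun N => f (qclass (relations v W) (emon N)))],
      exists f : {rmorphism quot_ring (@in_deg n @` relations v W) ->
                            graded (heaviside v W)},
        [/\ bijective f,
            forall i, f (qclass (@in_deg n @` relations v W) 'X_i) =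
                      gr_in (heaviside v W) 1 (heaviside v W i) &
            Zbasis (NBC v W)
              (fun N => f (qclass (@in_deg n @` relations v W) (emon N)))],
      is_Hilb v W (NBC_poly v W) &
      NBC_poly v W = Poin v W].
Proof.
split.
- have [f [bij fE basis]] := quotient_iso (@relations_vanish R l n v W)
    (@mpeval_heaviside_surj R l n v W) (@nbc_span_relations R l n v W)
    (@VG_indep R l n v W v_neq0).
  by exists f; split=> // i; rewrite fE /= mpevalX.
- have [f [bij fE basis]] := quotient_iso (@in_deg_vanish R l n v W)
    (@mpeval_gr_surj _ _ (heaviside v W)) (@nbc_span_in_deg R l n v W)
    (@graded_indep R l n v W v_neq0).
  by exists f; split=> // i; rewrite fE /= mpevalX.
- exact: NBC_Hilb.
- exact: NBC_poly_Poin.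
Qed.
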